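(* Assume the standing hypotheses of the context and let $\varepsilon\in(0,\varepsilon_0]$. Let $\bar{\boldsymbol\rho}=(\bar\rho_1,\bar\rho_2)\in\mathfrak X_0$ be any global minimizer of $\mathcal E_\varepsilon$ over $\mathcal P_2(\mathbb R^d)^2$. Then there are constants $C_1,C_2>0$ such that on $\mathbb R^d$ \[F_1'(\bar\rho_1)+\varepsilon\partial_{r_1}h(\bar\rho_1,\bar\rho_2)=(C_1-K*\bar\rho_2)_+,\qquad F_2'(\bar\rho_2)+\varepsilon\partial_{r_2}h(\bar\rho_1,\bar\rho_2)=(C_2-K*\bar\rho_1)_+ ,\] and the supports of $\bar\rho_1,\bar\rho_2$ are the compact convex sets \[\mathrm{supp}\,\bar\rho_1=\{K*\bar\rho_2\le C_1\},\qquad \mathrm{supp}\,\bar\rho_2=\{K*\bar\rho_1\le C_2\}.\]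
   Context: Let $d\ge1$. Standing hypotheses. (K): $K:\mathbb R^d\to[0,\infty)$ radially symmetric, $K(0)=0$, $K\in C^2$, $\nabla^2K\ge\lambda\,\mathrm{Id}$ for some $\lambda>0$, $\|\nabla^2K\|\le C_K$. (F): for $j=1,2$, $F_j:[0,\infty)\to[0,\infty)$ is $C^2$, $F_j''>0$ on $(0,\infty)$, $F_j(0)=F_j'(0)=0$, $\liminf_{r\to\infty}F_j''(r)>0$, $\limsup_{r\to\infty}F_j'(r)/F_j(r)<\infty$; there are $m_j,M_j>0,\beta_j\ge0,r_0>0$ with $m_jr^{\beta_j}\le F_j''(r)\le M_jr^{\beta_j}$ on $[0,r_0]$; $F_j(r)-rF_j'(r)+r^2F_j''(r)\ge0$. (h): $h:[0,\infty)^2\to\mathbb R$ is $C^2$, $h$ and $\nabla h$ vanish on $\{r_1=0\}\cup\{r_2=0\}$. ($\theta$): with $\theta_{j,i}(\mathbf u)=\partial_{r_i}\partial_{r_j}h(\mathbf r)/F_i''(r_i)$, $r_k=(F_k')^{-1}(u_k)$, each $\theta_{j,i}$ is locally Lipschitz on $[0,\infty)^2$ and $|\theta_{j,i}(\mathbf u)|\le\kappa_{j,i}\min\{1,u_1,u_2,\sqrt{(F_i')^{-1}(u_i)/(F_j')^{-1}(u_j)}\}$ for constants $\kappa_{j,i}>0$. Notation: $\mathcal P_2(\mathbb R^d)$ probability measures with finite second moment (absolutely continuous ones identified with densities); $\mathfrak m_1[\rho]=\int x\rho$; $\mathfrak X_0=\{\boldsymbol\rho\in\mathcal P_2(\mathbb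 R^d)^2:\mathfrak m_1[\rho_1]+\mathfrak m_1[\rho_2]=0\}$; $\mathcal E_\varepsilon(\boldsymbol\rho)=\int[F_1(\rho_1)+F_2(\rho_2)+\varepsilon h(\rho_1,\rho_2)+\rho_1K*\rho_2]dx$, $=+\infty$ unless both components are absolutely continuous with integrand in $L^1$. $\varepsilon_0>0$ is a number such that $\mathbf r\mapsto F_1(r_1)+F_2(r_2)+2\varepsilon_0h(\mathbf r)$ is convex on $[0,\infty)^2$. *)

(* Defs.v *)
From HB Require Import structures.
From mathcomp Require Import all_boot all_order all_algebra.
From mathcomp Require Import all_classical all_reals all_analysis.
Set Implicit Arguments. Unset Strict Implicit. Unset Printing Implicit Defensive.
Import Order.TTheory GRing.Theory Num.Theory.
Import numFieldNormedType.Exports.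
Local Open Scope classical_set_scope.
Local Open Scope ring_scope.

Definition enorm {R : realType} {n : nat} (x : 'rV[R]_n) : R :=
  Num.sqrt (\sum_(i < n) x ord0 i ^+ 2).

(** Lebesgue integral on R^n of a nonnegative (Borel) function, computed as
    the iterated one-dimensional Lebesgue integral (Tonelli). *)
Fixpoint iint {R : realType} (n : nat) : ('rV[R]_n -> \bar R) -> \bar R :=
  match n return ('rV[R]_n -> \bar R) -> \bar R with
  | O => fun g => g 0
  | S n' => fun g =>
      (\int[@lebesgue_measure R]_t
         iint (fun v : 'rV[R]_n' => g (row_mx (const_mx t : 'rV[R]_1) v)))%E
  end.

Definition borel_set {R : realType} {n : nat} (A : set 'rV[R]_n) : Prop :=
  <<s open >> A.

Definition borel_fun {R : realType} {n : nat} (f : 'rV[R]_n -> R) : Prop :=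
  forall B : set R, measurable B -> borel_set (f @^-1` B).

Definition L1 {R : realType} {n : nat} (f : 'rV[R]_n -> R) : Prop :=
  borel_fun f /\ (iint (fun x => (`|f x|)%:E) < +oo)%E.

(** Integral of a (signed) real function, meaningful when L1 f. *)
Definition Rint {R : realType} {n : nat} (f : 'rV[R]_n -> R) : R :=
  fine (iint (fun x => (Num.max (f x) 0)%:E))
  - fine (iint (fun x => (Num.max (- f x) 0)%:E)).

Definition ae_Rd {R : realType} {n : nat} (P : 'rV[R]_n -> Prop) : Prop :=
  exists N : set 'rV[R]_n, borel_set N /\
    iint (fun x => (\1_N x : R)%:E) = 0%E /\ forall x, ~ N x -> P x.

Definition P2dens {R : realType} {n : nat} (rho : 'rV[R]_n -> R) : Prop :=
  [/\ borel_fun rho, (forall x, 0 <= rho x),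
      iint (fun x => (rho x)%:E) = 1%E &
      (iint (fun x => (enorm x ^+ 2 * rho x)%:E) < +oo)%E].

Definition mom1 {R : realType} {n : nat} (rho : 'rV[R]_n -> R) : 'rV[R]_n :=
  \row_(i < n) Rint (fun x => x ord0 i * rho x).

Definition inX0 {R : realType} {n : nat} (rho1 rho2 : 'rV[R]_n -> R) : Prop :=
  [/\ P2dens rho1, P2dens rho2 & mom1 rho1 + mom1 rho2 = 0].

Definition convol {R : realType} {n : nat} (K rho : 'rV[R]_n -> R) (x : 'rV[R]_n) : R :=
  fine (iint (fun y => (K (x - y) * rho y)%:E)).

Definition energy {R : realType} {n : nat} (K : 'rV[R]_n -> R) (F1 F2 : R -> R)
  (h : R -> R -> R) (eps : R) (rho1 rho2 : 'rV[R]_n -> R) : \bar R :=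
  let f := fun x => F1 (rho1 x) + F2 (rho2 x) + eps * h (rho1 x) (rho2 x)
                    + rho1 x * convol K rho2 x in
  if pselect (L1 f) then (Rint f)%:E else (+oo)%E.

Definition supp_dens {R : realType} {n : nat} (rho : 'rV[R]_n -> R) : set 'rV[R]_n :=
  [set x | forall r : R, 0 < r ->
     (0 < iint (fun y => (rho y * \1_[set z | enorm (z - x) < r] y)%:E))%E].

Definition convex_set_rV {R : realType} {n : nat} (A : set 'rV[R]_n) : Prop :=
  forall x y, A x -> A y -> forall t : R, 0 <= t <= 1 -> A (t *: x + (1 - t) *: y).

Definition Khyp {R : realType} {n : nat} (K : 'rV[R]_n -> R) : Prop :=
  [/\ (forall x, 0 <= K x), K 0 = 0,
      (forall x y, enorm x = enorm y -> K x = K y),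
      (* K is C^2: all first and second directional derivatives exist, and the
         second ones are continuous *)
      [/\ (forall x v, derivable K x v),
          (forall x v w, derivable ('D_w K) x v) &
          (forall v w, continuous ('D_v ('D_w K)))] &
      exists lam CK : R, [/\ 0 < lam,
        (forall x v, lam * enorm v ^+ 2 <= 'D_v ('D_v K) x) &
        (forall x v w, `|'D_v ('D_w K) x| <= CK * enorm v * enorm w)]].

(** F is C^2 on [0,oo) with derivatives dF, d2F (one-sided at 0). *)
Definition C2_half {R : realType} (F dF d2F : R -> R) : Prop :=
  [/\ (forall r : R, 0 < r -> is_derive r 1 F (dF r) /\ is_derive r 1 dF (d2F r)),
      {within [set r | 0 <= r], continuous F},
      {within [set r | 0 <= r], continuous dF} &
      {within [set r | 0 <= r], continuous d2F}].

Definition Fhyp {R : realType} (F dF d2F : R -> R) : Prop :=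
  [/\ C2_half F dF d2F,
      (forall r, 0 <= r -> 0 <= F r),
      (forall r, 0 < r -> 0 < d2F r),
      F 0 = 0 /\ dF 0 = 0 &
      [/\ (* liminf_{r->oo} F''(r) > 0 *)
      (exists c M : R, 0 < c /\ forall r, M < r -> c <= d2F r),
      (* limsup_{r->oo} F'(r)/F(r) < oo *)
      (exists C M : R, forall r, M < r -> dF r / F r <= C),
      (exists m M beta r0 : R, [/\ 0 < m, 0 < M, 0 <= beta, 0 < r0 &
         forall r, 0 <= r <= r0 -> m * powR r beta <= d2F r <= M * powR r beta]) &
      (forall r, 0 <= r -> 0 <= F r - r * dF r + r ^+ 2 * d2F r)]].

Definition quadrant {R : realType} : set (R * R) := [set p | 0 <= p.1 /\ 0 <= p.2].

(** Hypothesis (h): h is C^2 on [0,oo)^2, with first partials h1 = d_{r1} h,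
    h2 = d_{r2} h and second partials hj_i = d_{r_i} d_{r_j} h. *)
Definition hhyp {R : realType} (h h1 h2 h1_1 h1_2 h2_1 h2_2 : R -> R -> R) : Prop :=
  [/\ (forall r1 r2 : R, 0 < r1 -> 0 < r2 ->
        [/\ is_derive r1 1 (fun s => h s r2) (h1 r1 r2),
            is_derive r2 1 (fun s => h r1 s) (h2 r1 r2) &
          [/\ is_derive r1 1 (fun s => h1 s r2) (h1_1 r1 r2),
            is_derive r2 1 (fun s => h1 r1 s) (h1_2 r1 r2),
            is_derive r1 1 (fun s => h2 s r2) (h2_1 r1 r2) &
            is_derive r2 1 (fun s => h2 r1 s) (h2_2 r1 r2)]]),
      (forall g, g \in [:: h; h1; h2; h1_1; h1_2; h2_1; h2_2] ->
         {within quadrant, continuous (fun p : R * R => g p.1 p.2)}) &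
      (forall r1 r2, 0 <= r1 -> 0 <= r2 -> (r1 = 0 \/ r2 = 0) ->
         [/\ h r1 r2 = 0, h1 r1 r2 = 0 & h2 r1 r2 = 0])].

Definition locLip_quadrant {R : realType} (th : R -> R -> R) : Prop :=
  forall M : R, exists L : R, forall u1 u2 v1 v2,
    0 <= u1 <= M -> 0 <= u2 <= M -> 0 <= v1 <= M -> 0 <= v2 <= M ->
    `|th u1 u2 - th v1 v2| <= L * (`|u1 - v1| + `|u2 - v2|).

Definition pick {R : realType} (k : nat) (r1 r2 : R) : R :=
  if k == 1%N then r1 else r2.

(** Hypothesis on theta_{j,i}(u) = d_{r_i} d_{r_j} h (r) / F_i''(r_i),
    r_k = (F_k')^{-1}(u_k); hji = d_{r_i} d_{r_j} h, d2Fi = F_i''. *)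
Definition theta_ok {R : realType} (j i : nat) (dF1 dF2 d2Fi : R -> R)
  (hji : R -> R -> R) : Prop :=
  exists (th : R -> R -> R) (kappa : R), [/\ 0 < kappa, locLip_quadrant th &
    forall r1 r2, 0 <= r1 -> 0 <= r2 ->
      let u1 := dF1 r1 in let u2 := dF2 r2 in
      (d2Fi (pick i r1 r2) != 0 -> th u1 u2 = hji r1 r2 / d2Fi (pick i r1 r2)) /\
      `|th u1 u2| <= kappa * Num.min 1 (Num.min u1 (Num.min u2
                       (Num.sqrt (pick i r1 r2 / pick j r1 r2))))].

Definition convex_quadrant {R : realType} (G : R -> R -> R) : Prop :=
  forall r1 r2 s1 s2 t : R, 0 <= r1 -> 0 <= r2 -> 0 <= s1 -> 0 <= s2 -> 0 <= t <= 1 ->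
    G (t * r1 + (1 - t) * s1) (t * r2 + (1 - t) * s2)
      <= t * G r1 r2 + (1 - t) * G s1 s2.

(* Main.v *)
Require Import Defs.
From HB Require Import structures.
From mathcomp Require Import all_boot all_order all_algebra.
From mathcomp Require Import all_classical all_reals all_analysis.
From mathcomp Require Import measurable_realfun ring lra.
Set Implicit Arguments. Unset Strict Implicit. Unset Printing Implicit Defensive.
Import Order.TTheory GRing.Theory Num.Theory.
Import numFieldNormedType.Exports.
Local Open Scope classical_set_scope.
Local Open Scope ring_scope.

(** For fixed second component the energy is convex in the first one, so it
    suffices to move mass around in one component.  Let
    [g = F1'(rho1) + eps * d1 h(rho1, rho2) + K * rho2] be the marginal cost of
    mass at a point.  If [g < a] on a set of positive measure and [g > b > a] on a
    set of positive measure where [rho1 > 0], moving a little mass from the second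
    set to the first lowers the energy; since all integrands are nonnegative, the
    slope inequalities of convex functions give this without differentiating under
    the integral.  Hence [g >= C1] a.e., with equality where [rho1 > 0].  As
    [eps <= eps0], the integrand minus half of [F1 + F2] is still convex, so the
    partial derivative of the integrand is positive exactly where [rho1 > 0]; thus
    [{rho1 > 0}] is a.e. the open sublevel set [{K * rho2 < C1}] of a convex,
    continuous, coercive function, and its closure is the compact convex set
    [{K * rho2 <= C1}].  The second equation follows by exchanging the two
    components, the interaction being symmetric by Tonelli. *)

(** * Lebesgue measure on row vectors *)

HB.instance Definition _ (R : realType) (n : nat) :=
  Measurable.copy 'rV[R]_n (g_sigma_algebraType (@open 'rV[R]_n)).

Section BorelRowVectors.
Context {R : realType}.

Lemma open_measurable_rV n (A : set 'rV[R]_n) : open A -> measurable A.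
Proof. exact: sub_sigma_algebra. Qed.

Lemma ball_measurable_rV n (x : 'rV[R]_n) r : measurable (ball x r).
Proof. by apply: open_measurable_rV; exact: ball_open. Qed.

Lemma within_continuous_measurable_rV n (D : set 'rV[R]_n) (f : 'rV[R]_n -> R) :
  measurable D -> {within D, continuous f} -> measurable_fun D f.
Proof.
move=> mD /continuousP cf; apply: (measurability _ (RGenOpens.measurableE R)).
move=> _ [_ [a [b ->] <-]].
have /cf/open_subspaceP[U oU UD] : open `]a, b[%classic by exact: interval_open.
rewrite setIC -UD; apply: measurableI => //; exact: open_measurable_rV.
Qed.

Lemma continuous_measurable_rV n (f : 'rV[R]_n -> R) :
  continuous f -> measurable_fun setT f.
Proof.
by move=> cf; apply: within_continuous_measurable_rV => //; exact: continuous_subspaceT.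
Qed.

Lemma measurable_coord_rV n (i : 'I_n) :
  measurable_fun setT (fun x : 'rV[R]_n => x ord0 i).
Proof. by apply: continuous_measurable_rV; exact: coord_continuous. Qed.

Lemma ball_rVE n (x : 'rV[R]_n) (r : R) : 0 < r ->
  ball x r = [set y : 'rV[R]_n | forall i, ball (x ord0 i) r (y ord0 i)].
Proof.
move=> r0; apply/seteqP; split=> y /=; first by case=> _ xy i; exact: xy.
by move=> xy; split=> // j i; rewrite (ord1 j).
Qed.

Definition rat_ball n (p : 'rV[rat]_n * nat) : set 'rV[R]_n :=
  ball (map_mx (@ratr R) p.1) p.2.+1%:R^-1.

Lemma rat_ball_near n (x : 'rV[R]_n) (r : R) : 0 < r ->
  exists p, rat_ball p x /\ rat_ball p `<=` ball x r.
Proof.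
move=> r0.
have [k _ /(_ k (leqnn k))/= kr] := near_infty_natSinv_lt (PosNum (divr_gt0 r0 (ltr0Sn R 1))).
have rat_coord i : exists q : rat, ball (x ord0 i) k.+1%:R^-1 (ratr q).
  have [|y [xy [q _ qy]]] := @dense_rat R _ _ (ball_open (x ord0 i) k.+1%:R^-1).
    by exists (x ord0 i); exact: ballxx.
  by exists q; rewrite qy.
have [q xq] := choice rat_coord.
have qx : rat_ball (\row_i q i, k) x.
  by rewrite /rat_ball ball_rVE//= => i; rewrite !mxE; exact: ball_sym.
exists (\row_i q i, k); split=> // y qy; rewrite (splitr r).
by apply: ball_triangle; apply: (le_ball (ltW kr)); [exact: ball_sym qx|exact: qy].
Qed.

Lemma open_bigcup_rat_ball n (A : set 'rV[R]_n) : open A ->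
  A = \bigcup_(p in [set p | rat_ball p `<=` A]) rat_ball p.
Proof.
move=> oA; apply/seteqP; split=> [x Ax|x [p pA /pA]//].
have /nbhs_ballP[r /= r0 rA] : nbhs x A by exact: open_nbhs_nbhs.
have [p [px pr]] := rat_ball_near x r0.
by exists p => //; exact: subset_trans rA.
Qed.

Lemma measurable_fun_rV d (T : measurableType d) n (f : T -> 'rV[R]_n) :
  (forall i, measurable_fun setT (fun x => f x ord0 i)) -> measurable_fun setT f.
Proof.
move=> mf; apply: (@measurability _ _ T 'rV[R]_n setT f (@open 'rV[R]_n)) => //.
move=> _ [A oA <-]; rewrite setTI (open_bigcup_rat_ball oA) preimage_bigcup.
rewrite bigcup_mkcond; apply: countable_bigcupT_measurable => // p; case: ifP => // _.
rewrite /rat_ball ball_rVE//.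
rewrite (_ : _ @^-1` _ = \bigcap_(i in [set: 'I_n])
   ((fun x => f x ord0 i) @^-1` ball (map_mx ratr p.1 ord0 i : R) p.2.+1%:R^-1)).
  rewrite bigcap_fset_set; last exact: finite_finset.
  apply: bigsetI_measurable => i _; rewrite -[X in measurable X]setTI.
  by apply: mf => //; exact: measurable_ball.
by apply/seteqP; split=> x /=; [move=> xp i _; exact: xp|move=> xp i; exact: xp].
Qed.

Definition cons_rV n (p : R * 'rV[R]_n) : 'rV[R]_n.+1 :=
  row_mx (const_mx p.1 : 'rV[R]_1) p.2.

Lemma cons_rV0 n (p : R * 'rV[R]_n) : cons_rV p ord0 ord0 = p.1.
Proof. by rewrite mxE; case: splitP => [j _|j]; rewrite ?mxE. Qed.

Lemma cons_rVS n (p : R * 'rV[R]_n) i : cons_rV p ord0 (lift ord0 i) = p.2 ord0 i.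
Proof.
rewrite mxE; case: splitP => [j|j]; first by rewrite (ord1 j).
by rewrite lift0 add1n => -[/val_inj ->].
Qed.

Lemma measurable_cons_rV n : measurable_fun setT (@cons_rV n).
Proof.
apply: measurable_fun_rV => i; case: (unliftP ord0 i) => [j|] ->.
  under eq_fun do rewrite cons_rVS.
  by apply: (measurableT_comp (@measurable_coord_rV _ j)); exact: measurable_snd.
by under eq_fun do rewrite cons_rV0; exact: measurable_fst.
Qed.

Lemma preimage_cons_rV_ball n (x : 'rV[R]_n.+1) (r : R) : 0 < r ->
  @cons_rV n @^-1` ball x r =
  ball (x ord0 ord0) r `*` ball (\row_i x ord0 (lift ord0 i)) r.
Proof.
move=> r0; rewrite !ball_rVE//; apply/seteqP; split=> -[t v] /=.
  move=> xp; split=> /=; first by have := xp ord0; rewrite cons_rV0.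
  by move=> i; have := xp (lift ord0 i); rewrite cons_rVS mxE.
move=> [xt xv] i; case: (unliftP ord0 i) => [j|] ->; last by rewrite cons_rV0.
by rewrite cons_rVS; have := xv j; rewrite mxE.
Qed.

End BorelRowVectors.

Section LebesgueRowVectors.
Context {R : realType}.
Local Open Scope ereal_scope.

Definition represents_iint n (mu : {measure set 'rV[R]_n -> \bar R}) :=
  forall g : 'rV[R]_n -> \bar R, measurable_fun setT g -> (forall x, 0 <= g x) ->
    iint g = \int[mu]_x g x.

Definition ball_volume n (mu : {measure set 'rV[R]_n -> \bar R}) :=
  forall x r, (0 < r)%R -> mu (ball x r) = ((2 * r) ^+ n)%:E.

Lemma ball_volume_sigma_finite n (mu : {measure set 'rV[R]_n -> \bar R}) :
  ball_volume mu -> sigma_finite setT mu.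
Proof.
move=> mu_ball; exists (fun k => ball 0%R k.+1%:R).
  apply/seteqP; split=> // x _; exists (Num.truncn `|x|) => //.
  by rewrite -ball_normE /= sub0r normrN; exact: truncnS_gt.
by move=> k; rewrite mu_ball// ltry; split=> //; exact: ball_measurable_rV.
Qed.

Section Cons.
Variables (n : nat) (mu : {sigma_finite_measure set 'rV[R]_n -> \bar R}).

Let prod_mu := (@lebesgue_measure R \x mu)%E.

Let cons : measurableTypeR R * 'rV[R]_n -> 'rV[R]_n.+1 := @cons_rV R n.

Let mcons : measurable_fun setT cons. Proof. exact: measurable_cons_rV. Qed.

Definition cons_measure : set 'rV[R]_n.+1 -> \bar R := pushforward prod_mu cons.

Let cons_measure0 : cons_measure set0 = 0.
Proof. exact: measure0. Qed.

Let cons_measure_ge0 A : 0 <= cons_measure A.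
Proof. exact: measure_ge0. Qed.

Let cons_measure_sigma_additive : semi_sigma_additive cons_measure.
Proof. exact: measure_semi_sigma_additive. Qed.

HB.instance Definition _ := isMeasure.Build _ _ _ cons_measure
  cons_measure0 cons_measure_ge0 cons_measure_sigma_additive.

Lemma iint_cons_measure : represents_iint mu -> represents_iint cons_measure.
Proof.
move=> mu_iint g mg g0.
have mg_cons : measurable_fun setT (g \o cons) by exact: measurableT_comp.
rewrite (@ge0_integral_pushforward _ _ _ _ _ _ mcons prod_mu setT)//.
rewrite preimage_setT /prod_mu fubini_tonelli1//; last by move=> p; exact: g0.
apply: eq_integral => t _; apply: mu_iint => //.
exact: (measurableT_comp mg_cons (pair1_measurable t)).
Qed.

Lemma ball_volume_cons_measure : ball_volume mu -> ball_volume cons_measure.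
Proof.
move=> mu_ball x r r0.
rewrite [LHS](_ : _ = prod_mu (@cons_rV R n @^-1` ball x r))// preimage_cons_rV_ball//.
rewrite /prod_mu product_measure1E; [|exact: measurable_ball|exact: ball_measurable_rV].
by rewrite mu_ball// exprS EFinM mulr_natl; congr (_ * _); exact/lebesgue_measure_ball/ltW.
Qed.

End Cons.

Lemma lebesgue_rV_exists n : { mu : {sigma_finite_measure set 'rV[R]_n -> \bar R} |
  represents_iint mu /\ ball_volume mu }.
Proof.
elim: n => [|n [mu [mu_iint mu_ball]]].
  exists (dirac (0%R : 'rV[R]_0)); split=> [g mg g0|x r r0].
    by rewrite integral_dirac//= diracT mul1e.
  rewrite /= expr0 /dirac indicE mem_set//.
  by rewrite (_ : 0%R = x); [exact: ballxx|apply/rowP; case].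
have cons_ball := ball_volume_cons_measure mu_ball.
pose cons_mu : {sigma_finite_measure set 'rV[R]_n.+1 -> \bar R} :=
  HB.pack (cons_measure mu : set _ -> \bar R) (Measure.class (cons_measure mu))
    (Measure_isSigmaFinite.Build _ _ _ _ (ball_volume_sigma_finite cons_ball)).
by exists cons_mu; split; [exact: iint_cons_measure|exact: cons_ball].
Qed.

Definition leb n : {sigma_finite_measure set 'rV[R]_n -> \bar R} :=
  sval (lebesgue_rV_exists n).

Lemma iintE n (g : 'rV[R]_n -> \bar R) : measurable_fun setT g ->
  (forall x, 0 <= g x) -> iint g = \int[leb n]_x g x.
Proof. exact: (svalP (lebesgue_rV_exists n)).1. Qed.

Lemma leb_ball n (x : 'rV[R]_n) r : (0 < r)%R -> leb n (ball x r) = ((2 * r) ^+ n)%:E.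
Proof. exact: (svalP (lebesgue_rV_exists n)).2. Qed.

Lemma leb_open_gt0 n (A : set 'rV[R]_n) : open A -> A !=set0 -> 0 < leb n A.
Proof.
move=> oA [x Ax]; have /nbhs_ballP[r /= r0 rA] : nbhs x A by exact: open_nbhs_nbhs.
apply: (@lt_le_trans _ _ (leb n (ball x r))).
  by rewrite leb_ball// lte_fin exprn_gt0// mulr_gt0.
by apply: le_measure => //; rewrite inE;
  [exact: ball_measurable_rV|exact: open_measurable_rV].
Qed.

Lemma ae_open_meets n (P : set 'rV[R]_n) (A : set 'rV[R]_n) : open A -> A !=set0 ->
  (\forall x \ae leb n, P x) -> exists2 x, A x & P x.
Proof.
move=> oA A0 aeP; apply: contrapT => AP.
have : leb n A = 0.
  apply: measure_negligible; first exact: open_measurable_rV.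
  by apply: negligibleS aeP => x Ax Px; apply: AP; exists x.
by move=> /eqP; rewrite gt_eqF// leb_open_gt0.
Qed.

Lemma iint_indic n (A : set 'rV[R]_n) : measurable A ->
  iint (fun x => (\1_A x : R)%:E) = leb n A.
Proof.
move=> mA; rewrite iintE; first by rewrite integral_indic// setIT.
- exact/measurable_EFinP/measurable_indic.
- by move=> x; rewrite lee_fin.
Qed.

Lemma ae_RdP n (P : 'rV[R]_n -> Prop) : ae_Rd P <-> \forall x \ae leb n, P x.
Proof.
split=> [[N [bN [N0 PN]]]|[N [mN N0 PN]]]; exists N; split=> //.
- by rewrite -N0; apply/esym/iint_indic.
- by move=> x /= Px; apply: contrapT => /PN.
- split=> [|x Nx]; first by rewrite iint_indic.
  by apply: contrapT => Px; exact/Nx/PN.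
Qed.

End LebesgueRowVectors.

(** * Integrals of nonnegative real functions *)

Section Ge0IntegralEFin.
Context d (T : measurableType d) (R : realType) (mu : {measure set T -> \bar R}).
Implicit Types f g : T -> R.
Local Open Scope ereal_scope.

Lemma integral_EFin_ge0 f : (forall x, 0 <= f x)%R -> 0 <= \int[mu]_x (f x)%:E.
Proof. by move=> f0; apply: integral_ge0 => x _; rewrite lee_fin. Qed.

Lemma ge0_integralD_EFin f g : measurable_fun setT f -> measurable_fun setT g ->
  (forall x, 0 <= f x)%R -> (forall x, 0 <= g x)%R ->
  \int[mu]_x (f x + g x)%:E = \int[mu]_x (f x)%:E + \int[mu]_x (g x)%:E.
Proof.
move=> mf mg f0 g0; under eq_integral do rewrite EFinD.
by rewrite ge0_integralD//; try exact/measurable_EFinP; move=> x _; rewrite lee_fin.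
Qed.

Lemma ge0_integralM_EFin k f : measurable_fun setT f -> (forall x, 0 <= f x)%R ->
  (0 <= k)%R -> \int[mu]_x (k * f x)%:E = k%:E * \int[mu]_x (f x)%:E.
Proof.
move=> mf f0 k0; under eq_integral do rewrite EFinM.
by rewrite ge0_integralZl_EFin//; try exact/measurable_EFinP; move=> x _; rewrite lee_fin.
Qed.

Lemma ge0_le_integral_EFin f g : measurable_fun setT f -> measurable_fun setT g ->
  (forall x, 0 <= f x)%R -> (forall x, f x <= g x)%R ->
  \int[mu]_x (f x)%:E <= \int[mu]_x (g x)%:E.
Proof.
move=> mf mg f0 fg.
by apply: ge0_le_integral => //; try exact/measurable_EFinP; move=> x _; rewrite lee_fin.
Qed.

Lemma measurable_scaled_indic (k : R) A : measurable A ->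
  measurable_fun setT (fun x : T => k * \1_A x)%R.
Proof. by move=> mA; apply: measurable_funM => //; exact: measurable_indic. Qed.

Lemma integral_scaled_indic (k : R) A : (0 <= k)%R -> measurable A ->
  \int[mu]_x (k * \1_A x)%:E = k%:E * mu A.
Proof.
by move=> k0 mA; rewrite ge0_integralM_EFin// integral_indic// setIT.
Qed.

Lemma ge0_integral_EFin_eq0P f : measurable_fun setT f -> (forall x, 0 <= f x)%R ->
  \int[mu]_x (f x)%:E = 0 <-> \forall x \ae mu, f x = 0%R.
Proof.
move=> mf f0; have mEf : measurable_fun setT (EFin \o f) by exact/measurable_EFinP.
rewrite (_ : \int[mu]_x (f x)%:E = \int[mu]_x `|(EFin \o f) x|); last first.
  by apply: eq_integral => x _; rewrite /= ger0_norm.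
rewrite (ae_eq_integral_abs _ _ mEf)//.
by split; apply: filterS => x /=; [move=> /(_ I)[]|move=> ->].
Qed.

Lemma measurable_set_le f g : measurable_fun setT f -> measurable_fun setT g ->
  measurable [set x | f x <= g x]%R.
Proof. by move=> mf mg; rewrite -[X in measurable X]setTI; exact: measurable_fun_le. Qed.

End Ge0IntegralEFin.

(** * Convex functions *)

Section ConvexFunction.
Context {R : realType}.

Lemma convex_functionP (V : lmodType R) (D : set V) (f : V -> R) :
  convex_function D f <->
  forall x y t, D x -> D y -> 0 <= t <= 1 ->
    f (t *: x + (1 - t) *: y) <= t * f x + (1 - t) * f y.
Proof.
split=> [cf x y t Dx Dy /andP[t0 t1]|cf t x y /set_mem Dx /set_mem Dy].
  exact: (cf (Itv01 t0 t1) x y (mem_set Dx) (mem_set Dy)).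
by apply: cf => //; rewrite ge0 le1.
Qed.

Lemma convex_comb_line (V : lmodType R) (x v : V) (a b t : R) :
  t *: (x + a *: v) + (1 - t) *: (x + b *: v) = x + (t * a + (1 - t) * b) *: v.
Proof.
by rewrite !scalerDr !scalerA addrACA -!scalerDl addrCA subrr addr0 scale1r.
Qed.

Lemma convex_dist_le (V : normedModType R) (f : V -> R) (x v : V) (r M : R) :
  convex_function setT f -> 0 < r ->
  (forall z, `|z - x| <= r -> f z <= M) -> `|v| <= r ->
  `|f (x + v) - f x| <= `|v| / r * (M - f x).
Proof.
move=> /convex_functionP cf r0 fM vr.
have [->|v0] := eqVneq v 0; first by rewrite addr0 subrr !normr0 !mul0r.
have nv0 : 0 < `|v| by rewrite normr_gt0.
pose s := `|v| / r; have s0 : 0 < s by rewrite divr_gt0.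
have s1 : s <= 1 by rewrite ler_pdivrMr// mul1r.
have f_end a : `|a| = s^-1 -> f (x + a *: v) <= M.
  by move=> anorm; apply: fM; rewrite addrAC subrr add0r normrZ anorm invf_div divfK ?gt_eqF.
have upper : f (x + v) <= s * M + (1 - s) * f x.
  have := cf (x + s^-1 *: v) (x + 0 *: v) s I I; rewrite convex_comb_line (ltW s0) s1.
  rewrite mulr0 addr0 mulfV ?gt_eqF// scale1r scale0r addr0 => /(_ isT)/le_trans; apply.
  by rewrite lerD2r ler_wpM2l ?f_end ?gtr0_norm ?invr_gt0// ltW.
have lower : (1 + s) * f x <= f (x + v) + s * M.
  pose t := (1 + s)^-1.
  have t01 : 0 <= t <= 1 by rewrite invr_ge0 invf_le1 ?lerDl ?addr_ge0 ?addr_gt0 ?ltW.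
  have := cf (x + 1 *: v) (x + - s^-1 *: v) t I I t01.
  rewrite convex_comb_line scale1r (_ : t * 1 + _ = 0); last by rewrite /t; field; lra.
  have := f_end (- s^-1); rewrite normrN gtr0_norm ?invr_gt0// => /(_ erefl) endM.
  rewrite scale0r addr0 => fx_le.
  have -> : f (x + v) + s * M = (1 + s) * (t * f (x + v) + (1 - t) * M).
    by rewrite /t; field; lra.
  apply: ler_wpM2l; first by lra.
  by apply: le_trans fx_le _; rewrite lerD2l ler_wpM2l// subr_ge0; case/andP: t01.
by rewrite -/s ler_norml; apply/andP; split; lra.
Qed.

Lemma convex_le_continuous (V : normedModType R) (f g : V -> R) :
  convex_function setT f -> continuous g ->
  (forall x, f x <= g x) -> continuous f.
Proof.
move=> cf cg fg x; pose M := g x + 1.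
have /nbhs_ballP[r /= r0 gM] : \forall z \near x, g z <= M.
  by apply: cvgr_le (cg x) _ _; rewrite ltrDl.
have r20 : 0 < r / 2 by rewrite divr_gt0.
have fM z : `|z - x| <= r / 2 -> f z <= M.
  move=> zx; apply: le_trans (fg z) (gM _ _).
  by rewrite -ball_normE /= distrC; lra.
pose C := (M - f x) / (r / 2).
have dist_cvg0 : `|y - x| * C @[y --> x] --> (0 : R).
  rewrite -(mul0r C); apply: cvgMr_tmp; rewrite -[X in _ --> X](@normr0 _ V) -(subrr x).
  by apply: cvg_norm; apply: cvgB; [exact: cvg_id|exact: cvg_cst].
apply: (@squeeze_cvgr _ _ _ _ (fun y => f x - `|y - x| * C) (fun y => f x + `|y - x| * C)).
- near=> y; have := @convex_dist_le _ f x (y - x) _ _ cf r20 fM.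
  rewrite (addrC x) subrK -mulrA (mulrC _^-1) -/C => dist_le; rewrite -ler_distl; apply: dist_le.
  near: y; apply/nbhs_ballP; exists (r / 2) => //= y.
  by rewrite -ball_normE /= distrC => /ltW.
- by rewrite -[X in _ --> X]subr0; apply: cvgB => //; exact: cvg_cst.
- by rewrite -[X in _ --> X]addr0; apply: cvgD => //; exact: cvg_cst.
Unshelve. all: by end_near. Qed.

End ConvexFunction.

(** * The Euclidean norm *)

Section EuclideanNorm.
Context {R : realType} {n : nat}.
Implicit Types x y z : 'rV[R]_n.

Lemma enorm_ge0 x : 0 <= enorm x.
Proof. exact: sqrtr_ge0. Qed.

Lemma sqr_enorm x : enorm x ^+ 2 = \sum_(i < n) x ord0 i ^+ 2.
Proof. by rewrite sqr_sqrtr// sumr_ge0// => i _; exact: sqr_ge0. Qed.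

Lemma enormZ k x : enorm (k *: x) = `|k| * enorm x.
Proof.
rewrite /enorm -sqrtr_sqr -sqrtrM ?sqr_ge0// mulr_sumr.
by congr Num.sqrt; apply: eq_bigr => i _; rewrite mxE exprMn.
Qed.

Lemma enormN x : enorm (- x) = enorm x.
Proof. by rewrite -scaleN1r enormZ normrN1 mul1r. Qed.

Lemma sqr_enormD_le x y : enorm (x + y) ^+ 2 <= 2 * enorm x ^+ 2 + 2 * enorm y ^+ 2.
Proof.
rewrite !sqr_enorm !mulr_sumr -big_split/=; apply: ler_sum => i _; rewrite mxE.
by have := sqr_ge0 (x ord0 i - y ord0 i); nra.
Qed.

Lemma normr_le_enorm x : `|x| <= enorm x.
Proof.
rewrite [leLHS]/Num.norm/= mx_normrE; apply/bigmax_leP; split; first exact: enorm_ge0.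
move=> [i j] _ /=; rewrite (ord1 i) -sqrtr_sqr; apply: ler_wsqrtr.
by rewrite (bigD1 j)//= lerDl sumr_ge0// => k _; exact: sqr_ge0.
Qed.

Lemma continuous_enorm : continuous (@enorm R n).
Proof.
move=> x; apply: (@continuous_comp _ _ _ _ Num.sqrt); last exact: sqrt_continuous.
apply: continuous_big => [|i _]; first exact: add_continuous.
move=> y; apply: (@continuous_comp _ _ _ (fun z => z ord0 i) (fun r : R => r ^+ 2)).
  exact: coord_continuous.
exact: exprn_continuous.
Qed.

Lemma continuous_sqr_enorm : continuous (fun x : 'rV[R]_n => enorm x ^+ 2).
Proof.
move=> x; apply: (@continuous_comp _ _ _ _ (fun r : R => r ^+ 2)).
  exact: continuous_enorm.
exact: exprn_continuous.
Qed.

Lemma continuous_quadratic (A B : R) : continuous (fun x : 'rV[R]_n => A * enorm x ^+ 2 + B).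
Proof.
move=> x; apply: (@cvgD _ _ _ (nbhs x)); last exact: cvg_cst.
by apply: (@cvgMl_tmp _ _ (nbhs x)); exact: (@continuous_sqr_enorm x).
Qed.

Lemma measurable_sqr_enorm : measurable_fun setT (fun x : 'rV[R]_n => enorm x ^+ 2).
Proof. by apply: continuous_measurable_rV; exact: continuous_sqr_enorm. Qed.

Lemma measurable_sqr_enormM (f : 'rV[R]_n -> R) : measurable_fun setT f ->
  measurable_fun setT (fun x => enorm x ^+ 2 * f x).
Proof. by move=> mf; apply: measurable_funM => //; exact: measurable_sqr_enorm. Qed.

Lemma sqr_enormM_ge0 x k : 0 <= k -> 0 <= enorm x ^+ 2 * k.
Proof. by move=> k0; rewrite mulr_ge0// sqr_ge0. Qed.

Definition eball x (r : R) : set 'rV[R]_n := [set z | enorm (z - x) < r].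

Lemma eball_sub_ball x r : eball x r `<=` ball x r.
Proof.
move=> z; rewrite -ball_normE /= distrC; exact: le_lt_trans (normr_le_enorm _).
Qed.

Lemma open_eball x r : open (eball x r).
Proof.
have cont : continuous (fun z => enorm (z - x)).
  move=> z; apply: (@continuous_comp _ _ _ (fun z => z - x)); last exact: continuous_enorm.
  by apply: (@cvgB _ _ _ (nbhs z)); [exact: cvg_id|exact: cvg_cst].
by move/continuousP: cont => /(_ _ (@open_lt R r)).
Qed.

Lemma measurable_eball x r : measurable (eball x r).
Proof. by apply: open_measurable_rV; exact: open_eball. Qed.

Lemma leb_sub_eball_lty (A : set 'rV[R]_n) x r : measurable A -> A `<=` eball x r ->
  (leb n A < +oo)%E.
Proof.
move=> mA Ar; apply: (@le_lt_trans _ _ (leb n (ball x (Num.max 1 r)))).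
  apply: le_measure; rewrite ?inE//; first exact: ball_measurable_rV.
  by move=> z /Ar zr; apply: eball_sub_ball; rewrite /eball/= lt_max zr orbT.
by rewrite leb_ball ?lt_max ?ltr01// ltry.
Qed.

Lemma near_eball x : \forall k \near \oo, eball 0 k.+1%:R x.
Proof.
near=> k; rewrite /eball/= subr0; near: k.
exists (Num.truncn (enorm x)) => // k /= xk; apply: lt_le_trans (truncnS_gt _) _.
by rewrite ler_nat ltnS.
Unshelve. all: by end_near. Qed.

Lemma ae_exhaustion (P : set 'rV[R]_n) (F : nat -> set 'rV[R]_n) :
  (forall x, ~ P x -> \forall k \near \oo, F k x) ->
  (forall k, measurable (F k)) -> (forall k, leb n (F k `&` eball 0 k.+1%:R) = 0%E) ->
  \forall x \ae leb n, P x.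
Proof.
move=> PF mF F0.
have union_null : (leb n).-negligible (\bigcup_k (F k `&` eball 0 k.+1%:R)).
  apply: negligible_bigcup => k; apply/negligibleP; last exact: F0.
  by apply: measurableI => //; exact: measurable_eball.
apply: negligibleS union_null => x /PF Fx; near \oo => k; exists k => //.
by split; near: k; [exact: Fx|exact: near_eball].
Unshelve. all: by end_near. Qed.

End EuclideanNorm.

(** * Kernels of quadratic growth *)

Section SecondOrder.
Context {R : realType}.

Lemma tangent_line_le (f f1 f2 : R -> R) a b :
  (forall t : R, is_derive t 1 f (f1 t)) -> (forall t : R, is_derive t 1 f1 (f2 t)) ->
  (forall t, 0 <= f2 t) -> f a + f1 a * (b - a) <= f b.
Proof.
move=> df df1 f2_ge0.
have cont (g g1 : R -> R) c e : (forall t : R, is_derive t 1 g (g1 t)) ->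
    {within `[c, e], continuous g}.
  move=> dg; apply: continuous_subspaceT => t.
  by apply/differentiable_continuous/derivable1_diffP; exact: ex_derive.
have f1_mono c e : c <= e -> f1 c <= f1 e.
  rewrite le_eqVlt => /predU1P[->//|ce].
  have [t _] := MVT ce (fun t _ => df1 t) (cont _ _ c e df1).
  by have := f2_ge0 t; nra.
have [ab|ba|->] := ltgtP a b; last by lra.
- have [t + incrE] := MVT ab (fun t _ => df t) (cont _ _ a b df).
  by rewrite in_itv/= => /andP[/ltW/f1_mono slope_le _]; nra.
- have [t + incrE] := MVT ba (fun t _ => df t) (cont _ _ b a df).
  by rewrite in_itv/= => /andP[_ /ltW/f1_mono slope_le]; nra.
Qed.

Lemma taylor2_ge (f f1 f2 : R -> R) m a b :
  (forall t : R, is_derive t 1 f (f1 t)) -> (forall t : R, is_derive t 1 f1 (f2 t)) ->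
  (forall t, m <= f2 t) -> f a + f1 a * (b - a) + m / 2 * (b - a) ^+ 2 <= f b.
Proof.
move=> df df1 f2_ge.
have dlin k (t : R) : is_derive t 1 (fun s => k * s) k.
  apply: (is_derive_eq (is_deriveM (is_derive_cst k t 1) (is_derive_id t 1))).
  by rewrite /GRing.scale/=; ring.
have dsqr (t : R) : is_derive t 1 (fun s => m / 2 * s * s) (m * t).
  apply: (is_derive_eq (is_deriveM (dlin (m / 2) t) (is_derive_id t 1))).
  by rewrite /GRing.scale/=; field.
have f2m_ge0 t : 0 <= f2 t - m by rewrite subr_ge0.
have := @tangent_line_le (fun s => f s - m / 2 * s * s) (fun s => f1 s - m * s)
  (fun s => f2 s - m) a b (fun t => is_deriveB (df t) (dsqr t))
  (fun t => is_deriveB (df1 t) (dlin m t)) f2m_ge0.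
lra.
Qed.

Lemma is_derive_line (V : normedModType R) (f : V -> R) x v (t : R) :
  derivable f (x + t *: v) v ->
  is_derive t 1 (fun s => f (x + s *: v)) ('D_v f (x + t *: v)).
Proof.
move=> fv.
have quotientE : (fun h : R => h^-1 *: (((fun s => f (x + s *: v)) \o shift t) (h *: 1)
                                          - f (x + t *: v))) =
    (fun h => h^-1 *: ((f \o shift (x + t *: v)) (h *: v) - f (x + t *: v))).
  apply/funext => h /=; congr (_ *: (f _ - _)).
  have -> : h *: (1 : R) = h by exact: mulr1.
  by rewrite scalerDl addrCA.
by split; [rewrite /derivable quotientE|rewrite /derive quotientE].
Qed.

Section TwiceDerivable.
Variables (V : normedModType R) (f : V -> R).
Hypothesis df : forall x v, derivable f x v.
Hypothesis d2f : forall x v, derivable ('D_v f) x v.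

Let dline x v (t : R) : is_derive t 1 (fun s => f (x + s *: v)) ('D_v f (x + t *: v)).
Proof. exact: is_derive_line. Qed.

Let d2line x v (t : R) :
  is_derive t 1 (fun s => 'D_v f (x + s *: v)) ('D_v ('D_v f) (x + t *: v)).
Proof. exact: is_derive_line. Qed.

Lemma derive2_ge0_convex : (forall x v, 0 <= 'D_v ('D_v f) x) -> convex_function setT f.
Proof.
move=> d2_ge0; apply/convex_functionP => x y t _ _ /andP[t0 t1].
have tangent b := tangent_line_le t b (dline y (x - y)) (d2line y (x - y))
  (fun s => d2_ge0 (y + s *: (x - y)) _).
have := tangent 0; have := tangent 1.
rewrite scale0r scale1r addr0 (addrC y (x - y)) subrK.
have -> : y + t *: (x - y) = t *: x + (1 - t) *: y.
  by rewrite scalerBr scalerBl scale1r addrCA.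
by move: (f _) (f _) (f _) ('D__ f _) => fx fy fxy slope; nra.
Qed.

Lemma derive2_ge_second_difference x v m : (forall y, m <= 'D_v ('D_v f) y) ->
  2 * f x + m <= f (x + v) + f (x - v).
Proof.
move=> d2_ge.
have taylor b := taylor2_ge 0 b (dline x v) (d2line x v) (fun t => d2_ge (x + t *: v)).
have := taylor 1; have := taylor (-1).
by rewrite /= !subr0 scale0r addr0 scale1r scaleN1r sqrrN expr1n; lra.
Qed.

Lemma derive2_le_second_difference x v m : (forall y, 'D_v ('D_v f) y <= m) ->
  f (x + v) + f (x - v) <= 2 * f x + m.
Proof.
move=> d2_le.
have d2N_ge t : - m <= - 'D_v ('D_v f) (x + t *: v) by rewrite lerN2.
have taylor b : - f (x + 0 *: v) + - 'D_v f (x + 0 *: v) * (b - 0) +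
    - m / 2 * (b - 0) ^+ 2 <= - f (x + b *: v) :=
  taylor2_ge 0 b (fun t => is_deriveN (dline x v t)) (fun t => is_deriveN (d2line x v t)) d2N_ge.
have := taylor 1; have := taylor (-1).
by rewrite /= !subr0 scale0r addr0 scale1r scaleN1r sqrrN expr1n; lra.
Qed.

End TwiceDerivable.

End SecondOrder.

Section ConfiningKernel.
Context {R : realType} {n : nat}.
Implicit Types K : 'rV[R]_n -> R.

Definition confining_kernel K := [/\ forall x, K (- x) = K x, convex_function setT K &
  exists a c, [/\ 0 < a, 0 <= c &
    forall x, a * enorm x ^+ 2 <= K x <= c * enorm x ^+ 2]].

Definition quadratically_coercive (V : 'rV[R]_n -> R) :=
  exists A B, 0 < A /\ forall x, A * enorm x ^+ 2 - B <= V x.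

Lemma Khyp_confining K : Khyp K -> confining_kernel K.
Proof.
move=> [_ K00 K_radial [dK d2K _] [lam [CK [lam0 d2K_ge d2K_le]]]].
have Keven x : K (- x) = K x by apply: K_radial; rewrite enormN.
have d2Kv x v : derivable ('D_v K) x v by exact: d2K.
split=> //.
  apply: (derive2_ge0_convex dK d2Kv) => x v.
  by apply: le_trans (d2K_ge _ _); rewrite mulr_ge0 ?sqr_ge0// ltW.
exists (lam / 2), (`|CK| / 2); split; [by rewrite divr_gt0|by rewrite divr_ge0|move=> x].
have := derive2_ge_second_difference dK d2Kv 0 (d2K_ge ^~ x).
have d2K_abs y : 'D_x ('D_x K) y <= `|CK| * enorm x ^+ 2.
  apply: le_trans (ler_norm _) (le_trans (d2K_le y x x) _).
  by rewrite -mulrA -expr2 ler_wpM2r ?sqr_ge0// ler_norm.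
have := derive2_le_second_difference dK d2Kv 0 d2K_abs.
by rewrite sub0r add0r Keven K00 => ? ?; apply/andP; split; lra.
Qed.

Lemma confining_kernel_ge0 K x : confining_kernel K -> 0 <= K x.
Proof.
move=> [_ _ [a [_ [a0 _ /(_ x)/andP[+ _]]]]]; apply: le_trans.
by rewrite mulr_ge0 ?sqr_ge0// ltW.
Qed.

Lemma confining_kernel_continuous K : confining_kernel K -> continuous K.
Proof.
move=> [_ cvxK [a [c [_ _ K_bnd]]]].
apply: (convex_le_continuous cvxK (@continuous_quadratic _ _ c 0)) => x.
by have /andP[] := K_bnd x; rewrite addr0.
Qed.

End ConfiningKernel.

(** * Densities and convolutions *)

Section Densities.
Context {R : realType} {n : nat}.
Implicit Types (f rho : 'rV[R]_n -> R).
Local Notation mu := (@leb R n).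

Lemma borel_funP f : borel_fun f <-> measurable_fun setT f.
Proof.
split=> [bf _ B mB|mf B mB]; first by rewrite setTI; exact: bf.
by have := mf measurableT B mB; rewrite setTI.
Qed.

Lemma iint_EFin f : measurable_fun setT f -> (forall x, 0 <= f x) ->
  iint (fun x => (f x)%:E) = (\int[mu]_x (f x)%:E)%E.
Proof. by move=> mf f0; rewrite iintE//; exact/measurable_EFinP. Qed.

Lemma P2densP rho : P2dens rho <->
  [/\ measurable_fun setT rho, forall x, 0 <= rho x, (\int[mu]_x (rho x)%:E = 1)%E &
      (\int[mu]_x (enorm x ^+ 2 * rho x)%:E < +oo)%E].
Proof.
have momentE : measurable_fun setT rho -> (forall x, 0 <= rho x) ->
   iint (fun x => (enorm x ^+ 2 * rho x)%:E) = (\int[mu]_x (enorm x ^+ 2 * rho x)%:E)%E.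
  move=> mrho rho0; rewrite iint_EFin//; first exact: measurable_sqr_enormM.
  by move=> x; exact: sqr_enormM_ge0.
split=> [[/borel_funP mrho rho0 mass moment]|[mrho rho0 mass moment]].
  by split=> //; [rewrite -iint_EFin|rewrite -momentE].
by split=> //; [exact/borel_funP|rewrite iint_EFin|rewrite momentE].
Qed.

Lemma P2dens_measurable rho : P2dens rho -> measurable_fun setT rho.
Proof. by case/P2densP. Qed.

Lemma P2dens_ge0 rho x : P2dens rho -> 0 <= rho x.
Proof. by case/P2densP. Qed.

Lemma P2dens_not_ae0 rho : P2dens rho -> ~ \forall x \ae mu, rho x = 0.
Proof.
case/P2densP => mrho rho0 mass _ /(ge0_integral_EFin_eq0P _ mrho rho0).
by rewrite mass => /eqP; rewrite eqe oner_eq0.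
Qed.

Definition moment2 rho : R := fine (\int[mu]_x (enorm x ^+ 2 * rho x)%:E)%E.

Lemma moment2_ge0 rho : P2dens rho -> 0 <= moment2 rho.
Proof.
move=> /P2dens_ge0 rho0; apply/fine_ge0/integral_EFin_ge0 => x.
exact: sqr_enormM_ge0.
Qed.

Lemma integral_quadratic_density rho A B : P2dens rho -> 0 <= A -> 0 <= B ->
  (\int[mu]_x ((A * enorm x ^+ 2 + B) * rho x)%:E)%E = (A * moment2 rho + B)%:E.
Proof.
move=> /P2densP[mrho rho0 mass moment] A0 B0.
have msqr := measurable_sqr_enormM mrho.
have sqr0 x : 0 <= enorm x ^+ 2 * rho x by exact: sqr_enormM_ge0.
have momentE : (\int[mu]_x (enorm x ^+ 2 * rho x)%:E = (moment2 rho)%:E)%E.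
  by rewrite fineK// ge0_fin_numE//; exact: integral_EFin_ge0.
under eq_integral do rewrite mulrDl -mulrA.
rewrite ge0_integralD_EFin; [|exact: measurable_funM|exact: measurable_funM|
  by move=> x; rewrite mulr_ge0|by move=> x; rewrite mulr_ge0].
by rewrite !ge0_integralM_EFin// momentE mass mule1 -EFinM -EFinD.
Qed.

End Densities.

Section Convolution.
Context {R : realType} {n : nat} (K rho : 'rV[R]_n -> R).
Hypothesis K_confining : confining_kernel K.
Hypothesis rhoP : P2dens rho.
Local Notation mu := (@leb R n).
Local Notation V := (convol K rho).

Let mrho : measurable_fun setT rho. Proof. exact: P2dens_measurable. Qed.
Let rho_ge0 x : 0 <= rho x. Proof. exact: P2dens_ge0. Qed.
Let Krho_ge0 (x y : 'rV[R]_n) : 0 <= K (x - y) * rho y.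
Proof. by rewrite mulr_ge0// confining_kernel_ge0. Qed.

Lemma measurable_convol_integrand (x : 'rV[R]_n) :
  measurable_fun setT (fun y : 'rV[R]_n => K (x - y) * rho y).
Proof.
apply: measurable_funM => //; apply: continuous_measurable_rV => y.
apply: (@continuous_comp _ _ _ (fun y : 'rV[R]_n => x - y) K).
  by apply: (@cvgB _ _ _ (nbhs y)); [exact: cvg_cst|exact: cvg_id].
exact: confining_kernel_continuous.
Qed.

Let mquadratic A B : measurable_fun setT (fun y => (A * enorm y ^+ 2 + B) * rho y).
Proof.
apply: measurable_funM => //; apply: measurable_funD => //.
by apply: measurable_funM => //; exact: measurable_sqr_enorm.
Qed.

Lemma convol_integral_le : exists A B, [/\ 0 <= A, 0 <= B & forall x : 'rV[R]_n,
  (\int[mu]_y (K (x - y) * rho y)%:E <= (A * enorm x ^+ 2 + B)%:E)%E].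
Proof.
have [_ _ [a [c [_ c0 K_bnd]]]] := K_confining.
exists (2 * c), (2 * c * moment2 rho).
split; [by rewrite mulr_ge0|by rewrite !mulr_ge0// moment2_ge0|move=> x].
rewrite addrC -integral_quadratic_density ?mulr_ge0 ?enorm_ge0//.
apply: ge0_le_integral_EFin => // [|y]; first exact: measurable_convol_integrand.
rewrite ler_wpM2r//.
have /andP[_ /le_trans] := K_bnd (x - y); apply.
by have := ler_wpM2l c0 (sqr_enormD_le x (- y)); rewrite enormN; lra.
Qed.

Lemma convolE x : (V x)%:E = (\int[mu]_y (K (x - y) * rho y)%:E)%E.
Proof.
have [A [B [_ _ V_le]]] := convol_integral_le.
rewrite /convol iint_EFin//; last exact: measurable_convol_integrand.
rewrite fineK// ge0_fin_numE; last exact: integral_EFin_ge0.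
by apply: (le_lt_trans (V_le x)); rewrite ltry.
Qed.

Lemma convol_ge0 x : 0 <= V x.
Proof. by rewrite -lee_fin convolE; exact: integral_EFin_ge0. Qed.

Lemma convol_quadratic_le : exists A B, [/\ 0 <= A, 0 <= B &
  forall x, V x <= A * enorm x ^+ 2 + B].
Proof.
have [A [B [A0 B0 V_le]]] := convol_integral_le.
by exists A, B; split=> // x; rewrite -lee_fin convolE.
Qed.

Lemma convol_coercive : quadratically_coercive V.
Proof.
have [_ _ [a [c [a0 _ K_bnd]]]] := K_confining.
exists (a / 2), (a * moment2 rho); split=> [|x]; first by rewrite divr_gt0.
suff : a * enorm x ^+ 2 <= 2 * V x + (2 * a * moment2 rho + 0) by lra.
have sqr_ge : 0 <= a * enorm x ^+ 2 by rewrite mulr_ge0 ?sqr_ge0// ltW.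
have a2 : 0 <= 2 * a by rewrite mulr_ge0// ltW.
have mKrho := measurable_convol_integrand x.
rewrite -[leLHS]add0r -{1}(mul0r (moment2 rho)) -lee_fin.
rewrite [leRHS]EFinD [in leRHS]EFinM convolE.
rewrite -!integral_quadratic_density// -ge0_integralM_EFin// -ge0_integralD_EFin//; last 3 first.
- exact: measurable_funM.
- by move=> y; rewrite mulr_ge0.
- by move=> y; rewrite addr0 mulr_ge0// mulr_ge0// sqr_ge0.
apply: ge0_le_integral_EFin => //.
- by apply: measurable_funD => //; exact: measurable_funM.
- by move=> y; rewrite mul0r add0r mulr_ge0.
- move=> y; rewrite (mulrA 2) -mulrDl ler_wpM2r//.
  have /andP[K_ge _] := K_bnd (x - y).
  by have := ler_wpM2l (ltW a0) (sqr_enormD_le (x - y) y); rewrite subrK; lra.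
Qed.

Lemma convol_convex : convex_function setT V.
Proof.
have [_ /convex_functionP cvxK _] := K_confining.
apply/convex_functionP => x y t _ _ /andP[t0 t1].
have t1' : 0 <= 1 - t by rewrite subr_ge0.
have mKrho := measurable_convol_integrand.
rewrite -lee_fin EFinD !EFinM !convolE -!ge0_integralM_EFin// -ge0_integralD_EFin//;
  try (by apply: measurable_funM); try by move=> z; rewrite mulr_ge0.
apply: ge0_le_integral_EFin => //.
- by apply: measurable_funD => //; exact: measurable_funM.
- move=> z; rewrite !mulrA -mulrDl ler_wpM2r//.
  have -> : t *: x + (1 - t) *: y - z = t *: (x - z) + (1 - t) *: (y - z).
    by apply/rowP => i; rewrite !mxE; ring.
  by apply: cvxK => //; rewrite t0.
Qed.

Lemma convol_continuous : continuous V.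
Proof.
have [A [B [_ _ V_le]]] := convol_quadratic_le.
exact: (convex_le_continuous convol_convex (@continuous_quadratic _ _ A B) V_le).
Qed.

Lemma measurable_convol : measurable_fun setT V.
Proof. by apply: continuous_measurable_rV; exact: convol_continuous. Qed.

End Convolution.

Lemma convol_interaction_sym {R : realType} n (K rho1 rho2 : 'rV[R]_n -> R) :
  confining_kernel K -> P2dens rho1 -> P2dens rho2 ->
  (\int[leb n]_x (rho1 x * convol K rho2 x)%:E =
   \int[leb n]_x (rho2 x * convol K rho1 x)%:E)%E.
Proof.
move=> K_confining rho1P rho2P; have [Keven _ _] := K_confining.
have K_ge0 x : 0 <= K x by exact: confining_kernel_ge0.
have doubleE f g (fP : P2dens f) (gP : P2dens g) :
    (\int[leb n]_x (f x * convol K g x)%:E =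
     \int[leb n]_x \int[leb n]_y (f x * g y * K (x - y))%:E)%E.
  apply: eq_integral => x _; rewrite EFinM convolE// -ge0_integralM_EFin.
  - by apply: eq_integral => y _; rewrite mulrA mulrAC.
  - exact: measurable_convol_integrand.
  - by move=> y; rewrite mulr_ge0// (P2dens_ge0 _ gP).
  - exact: P2dens_ge0 fP.
pose f p := (rho1 p.1 * rho2 p.2 * K (p.1 - p.2))%:E.
have mf : measurable_fun setT f.
  have mrho1 := P2dens_measurable rho1P; have mrho2 := P2dens_measurable rho2P.
  apply/measurable_EFinP; apply: measurable_funM.
    by apply: measurable_funM; exact: measurableT_comp.
  apply: (@measurableT_comp _ _ _ _ _ _ K).
    by apply: continuous_measurable_rV; exact: confining_kernel_continuous.
  apply: measurable_fun_rV => i; under eq_fun do rewrite !mxE.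
  have mcoord := @measurable_coord_rV R n i.
  by apply: measurable_funB; exact: (measurableT_comp mcoord).
have f_ge0 p : (0 <= f p)%E.
  by rewrite lee_fin !mulr_ge0 ?(P2dens_ge0 _ rho1P) ?(P2dens_ge0 _ rho2P).
rewrite (doubleE _ _ rho1P rho2P) (doubleE _ _ rho2P rho1P).
transitivity (\int[leb n]_y \int[leb n]_x f (x, y))%E; first exact: fubini_tonelli.
apply: eq_integral => x _; apply: eq_integral => y _.
by rewrite /f/= -Keven opprB (mulrC (rho1 _)).
Qed.

(** * The Euler-Lagrange condition in one component *)

Lemma within_half_line_dist {R : realType} (f : R -> R) r e :
  {within [set r | 0 <= r], continuous f} -> 0 <= r -> 0 < e ->
  exists2 d, 0 < d & forall s, 0 <= s -> `|s - r| < d -> `|f s - f r| < e.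
Proof.
move=> /subspace_continuousP f_cont r0 e0.
have /cvgrPdistC_lt/(_ e e0)/nbhs_ballP[d /= d0 f_ball] := f_cont r r0.
by exists d => // s s0 sr; apply: f_ball => //; rewrite -ball_normE /= distrC.
Qed.

Section ConvexCost.
Context {R : realType}.

(* [f1] stands for the derivative of [f], of which only the slope inequalities are used. *)
Definition convex_cost (f f1 : R -> R) := [/\
  forall r, 0 <= r -> 0 <= f r, f1 0 = 0,
  {within [set r | 0 <= r], continuous f1},
  forall r s, 0 <= r -> r < s -> f1 r < f1 s &
  forall r s, 0 <= r -> 0 <= s -> s * f1 r <= f (r + s) - f r <= s * f1 (r + s)].

Variables f f1 : R -> R.
Hypothesis f_cost : convex_cost f f1.

Lemma convex_cost_ge0 r : 0 <= r -> 0 <= f r.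
Proof. by have [+ _ _ _ _] := f_cost; apply. Qed.

Lemma marginal_cost_homo r s : 0 <= r -> r <= s -> f1 r <= f1 s.
Proof.
have [_ _ _ f1_incr _] := f_cost.
by move=> r0; rewrite le_eqVlt => /predU1P[->//|rs]; rewrite ltW// f1_incr.
Qed.

Lemma marginal_cost_ge0 r : 0 <= r -> 0 <= f1 r.
Proof. by move=> r0; have [_ <- _ _ _] := f_cost; exact: marginal_cost_homo. Qed.

Lemma marginal_cost_gt0 r : 0 < r -> 0 < f1 r.
Proof. by move=> r0; have [_ f1_0 _ f1_incr _] := f_cost; rewrite -f1_0 f1_incr. Qed.

Lemma marginal_cost_pos r v C : 0 <= r -> f1 r = Num.max (C - v) 0 -> 0 < r <-> v < C.
Proof.
move=> r0 f1E; have f1_pos : 0 < r <-> 0 < f1 r.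
  split; first exact: marginal_cost_gt0.
  have [_ f1_0 _ _ _] := f_cost; move=> f1r.
  by rewrite lt0r r0 andbT; apply: contraTneq f1r => ->; rewrite f1_0 ltxx.
by rewrite f1_pos f1E lt_max ltxx orbF subr_gt0.
Qed.

Lemma marginal_cost_near r e : 0 <= r -> 0 < e ->
  \forall k \near \oo, forall s, 0 <= s -> `|s - r| <= k.+1%:R^-1 -> `|f1 s - f1 r| < e.
Proof.
move=> r0 e0; have [_ _ f1_cont _ _] := f_cost.
have [d d0 f1_dist] := within_half_line_dist f1_cont r0 e0.
near=> k => s s0 sr; apply: f1_dist => //.
by apply: le_lt_trans sr _; near: k; exact: near_infty_natSinv_lt (PosNum d0).
Unshelve. all: by end_near. Qed.

End ConvexCost.

Lemma le_addSinv {R : realType} (x y : R) :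
  (forall k : nat, x <= y + k.+1%:R^-1) -> x <= y.
Proof.
move=> xy; apply/ler_addgt0Pr => e e0.
have [k _ /(_ k (leqnn k))/= ke] := near_infty_natSinv_lt (PosNum e0).
by apply: le_trans (xy k) _; rewrite lerD2l ltW.
Qed.

Section IndicatorMoment.
Context {R : realType} {n : nat}.
Local Notation mu := (@leb R n).

Lemma sqr_enorm_indic_le (A : set 'rV[R]_n) r k x : 0 <= k -> A `<=` eball 0 r ->
  enorm x ^+ 2 * (k * \1_A x) <= r ^+ 2 * k * \1_A x.
Proof.
move=> k0 Ar; rewrite mulrA indicE.
have [/set_mem/Ar|_] := boolP (x \in A); last by rewrite !mulr0.
rewrite /eball/= subr0 !mulr1 => xr; rewrite ler_wpM2r// ler_pXn2r ?nnegrE ?enorm_ge0 ?ltW//.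
by apply: le_lt_trans xr; exact: enorm_ge0.
Qed.

Lemma moment_scaled_indic_lty (A : set 'rV[R]_n) r k : 0 <= k -> measurable A ->
  A `<=` eball 0 r -> (\int[mu]_x (enorm x ^+ 2 * (k * \1_A x))%:E < +oo)%E.
Proof.
move=> k0 mA Ar; apply: (@le_lt_trans _ _ (\int[mu]_x (r ^+ 2 * k * \1_A x)%:E)%E).
  apply: ge0_le_integral_EFin.
  - by apply: measurable_sqr_enormM; exact: measurable_scaled_indic.
  - exact: measurable_scaled_indic.
  - by move=> x; apply: sqr_enormM_ge0; rewrite mulr_ge0.
  - by move=> x; exact: sqr_enorm_indic_le.
have r2k0 : 0 <= r ^+ 2 * k by rewrite mulr_ge0// sqr_ge0.
rewrite integral_scaled_indic// lte_mul_pinfty//.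
exact: leb_sub_eball_lty Ar.
Qed.

End IndicatorMoment.

Section Transfer.
Context {R : realType} {n : nat} (rho : 'rV[R]_n -> R).
Hypothesis rhoP : P2dens rho.
Variables (A B : set 'rV[R]_n) (r s s' : R).
Local Notation mu := (@leb R n).

Definition transfer x := rho x + s * \1_A x - s' * \1_B x.

Lemma transfer_add x : A x -> ~ B x -> transfer x = rho x + s.
Proof. by move=> Ax Bx; rewrite /transfer !indicE mem_set// memNset// mulr1 mulr0 subr0. Qed.

Lemma transfer_remove x : ~ A x -> B x -> transfer x = rho x - s'.
Proof. by move=> Ax Bx; rewrite /transfer !indicE memNset// mem_set// mulr1 mulr0 addr0. Qed.

Lemma transfer_id x : ~ A x -> ~ B x -> transfer x = rho x.
Proof. by move=> Ax Bx; rewrite /transfer !indicE !memNset// !mulr0 subr0 addr0. Qed.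

Hypotheses (s_ge0 : 0 <= s) (s'_ge0 : 0 <= s').
Hypotheses (mA : measurable A) (mB : measurable B) (A_bounded : A `<=` eball 0 r).
Hypothesis B_removable : forall x, B x -> s' <= rho x.

Let mindic k (C : set 'rV[R]_n) : measurable C -> measurable_fun setT (fun x => k * (\1_C x : R)).
Proof. exact: measurable_scaled_indic. Qed.

Let indic_ge0 k (C : set 'rV[R]_n) x : 0 <= k -> 0 <= k * (\1_C x : R).
Proof. by move=> k0; rewrite mulr_ge0. Qed.

Lemma transfer_ge0 x : 0 <= transfer x.
Proof.
have rho_ge0 y : 0 <= rho y by exact: P2dens_ge0.
rewrite /transfer [\1_B x]indicE; have [Bx|nBx] := pselect (B x).
  by rewrite (mem_set Bx) mulr1 subr_ge0 (le_trans (B_removable Bx))// lerDl indic_ge0.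
by rewrite (memNset nBx) mulr0 subr0 addr_ge0// indic_ge0.
Qed.

Lemma measurable_transfer : measurable_fun setT transfer.
Proof.
apply: measurable_funB; last exact: mindic.
by apply: measurable_funD; [exact: P2dens_measurable|exact: mindic].
Qed.

Lemma integral_transfer : (s%:E * mu A = s'%:E * mu B)%E ->
  (\int[mu]_x (transfer x)%:E = 1)%E.
Proof.
move=> massE; have /P2densP[mrho rho_ge0 rho_mass _] := rhoP.
have : (\int[mu]_x (transfer x)%:E + s%:E * mu A = 1 + s%:E * mu A)%E.
  rewrite [in LHS]massE -[in LHS]integral_scaled_indic// -ge0_integralD_EFin//; last 4 first.
  - exact: measurable_transfer.
  - exact: mindic.
  - exact: transfer_ge0.
  - by move=> x; exact: indic_ge0.
  rewrite /transfer; under eq_integral do rewrite subrK.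
  rewrite ge0_integralD_EFin//; last 2 first.
  - exact: mindic.
  - by move=> x; exact: indic_ge0.
  by rewrite integral_scaled_indic// rho_mass.
move/(congr1 (fun z => z - s%:E * mu A)%E); rewrite !addeK//;
  by rewrite ge0_fin_numE ?mule_ge0// lte_mul_pinfty// (leb_sub_eball_lty mA A_bounded).
Qed.

Lemma moment_transfer_lty : (\int[mu]_x (enorm x ^+ 2 * transfer x)%:E < +oo)%E.
Proof.
have /P2densP[mrho rho_ge0 _ rho_moment] := rhoP.
apply: (@le_lt_trans _ _
  (\int[mu]_x (enorm x ^+ 2 * rho x + enorm x ^+ 2 * (s * \1_A x))%:E)%E).
  apply: ge0_le_integral_EFin.
  - by apply: measurable_sqr_enormM; exact: measurable_transfer.
  - by apply: measurable_funD; apply: measurable_sqr_enormM => //; exact: mindic.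
  - by move=> x; apply/sqr_enormM_ge0/transfer_ge0.
  - by move=> x; rewrite -mulrDr ler_wpM2l ?sqr_ge0// lerBlDr lerDl indic_ge0.
rewrite ge0_integralD_EFin; last 4 first.
- exact: measurable_sqr_enormM.
- by apply: measurable_sqr_enormM; exact: mindic.
- by move=> x; exact: sqr_enormM_ge0.
- by move=> x; apply: sqr_enormM_ge0; exact: indic_ge0.
by rewrite lte_add_pinfty// (moment_scaled_indic_lty _ mA A_bounded).
Qed.

Lemma P2dens_transfer : (s%:E * mu A = s'%:E * mu B)%E -> P2dens transfer.
Proof.
move=> massE; apply/P2densP; split.
- exact: measurable_transfer.
- exact: transfer_ge0.
- exact: integral_transfer.
- exact: moment_transfer_lty.
Qed.

End Transfer.

Section EulerLagrange.
Context {R : realType} {n : nat}.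
Variables (p p1 : 'rV[R]_n -> R -> R) (V rho : 'rV[R]_n -> R).
Local Notation mu := (@leb R n).
Local Notation J s := (\int[mu]_x (p x (s x) + s x * V x)%:E)%E.

Hypothesis p_cost : forall x, convex_cost (p x) (p1 x).
Hypothesis mp : forall s : 'rV[R]_n -> R, measurable_fun setT s -> (forall x, 0 <= s x) ->
  measurable_fun setT (fun x => p x (s x)).
Hypothesis mp1 : forall s : 'rV[R]_n -> R, measurable_fun setT s -> (forall x, 0 <= s x) ->
  measurable_fun setT (fun x => p1 x (s x)).
Hypothesis mV : measurable_fun setT V.
Hypothesis V_ge0 : forall x, 0 <= V x.
Hypothesis rhoP : P2dens rho.
Hypothesis J_fin : (J rho < +oo)%E.
Hypothesis J_min : forall s, P2dens s -> (J rho <= J s)%E.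

Let mrho : measurable_fun setT rho. Proof. exact: P2dens_measurable. Qed.
Let rho_ge0 x : 0 <= rho x. Proof. exact: P2dens_ge0. Qed.

Definition marginal x := p1 x (rho x) + V x.

(* Adding mass at most [tau] on [cheap tau a] costs at most [a] per unit, removing it
   from [dear tau b] saves at least [b].  The maximum is idle on [dear tau b]; it keeps
   the argument of [p1 x] in the half-line where [mp1] applies. *)
Definition cheap (tau a : R) := [set x | p1 x (rho x + tau) + V x <= a].

Definition dear (tau b : R) :=
  [set x | tau <= rho x] `&` [set x | b <= p1 x (Num.max (rho x - tau) 0) + V x].

Lemma marginal_ge0 x : 0 <= marginal x.
Proof. by rewrite addr_ge0// (marginal_cost_ge0 (p_cost x)). Qed.

Lemma measurable_cheap tau a : 0 <= tau -> measurable (cheap tau a).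
Proof.
move=> tau0; apply: measurable_set_le => //; apply: measurable_funD => //.
by apply: mp1 => [|x]; [exact: measurable_funD|rewrite addr_ge0].
Qed.

Lemma measurable_dear tau b : measurable (dear tau b).
Proof.
apply: measurableI; apply: measurable_set_le => //; apply: measurable_funD => //.
apply: mp1 => [|x]; last by rewrite le_max lexx orbT.
by apply: measurable_maxr => //; exact: measurable_funB.
Qed.

Lemma cheap_dear_disjoint tau tau' a b x : 0 <= tau -> 0 <= tau' -> a < b ->
  cheap tau a x -> ~ dear tau' b x.
Proof.
rewrite /cheap /dear/= => tau0 tau'0 ab xa [rho_tau xb].
have : p1 x (Num.max (rho x - tau') 0) <= p1 x (rho x + tau).
  apply: (marginal_cost_homo (p_cost x)); first by rewrite le_max lexx orbT.
  by rewrite max_l ?subr_ge0//; lra.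
lra.
Qed.

Lemma transfer_cost_le A B tau tau' a b s s' x : a < b ->
  0 <= s <= tau -> 0 <= s' <= tau' -> A `<=` cheap tau a -> B `<=` dear tau' b ->
  let r := transfer rho A B s s' x in
  p x r + r * V x + s' * b * \1_B x <= p x (rho x) + rho x * V x + s * a * \1_A x.
Proof.
move=> ab /andP[s0 s_tau] /andP[s'0 s'_tau] A_cheap B_dear /=.
have AB y : A y -> ~ B y.
  move=> /A_cheap Ay /B_dear.
  exact: (cheap_dear_disjoint (le_trans s0 s_tau) (le_trans s'0 s'_tau) ab Ay).
have [_ _ _ _ p_slope] := p_cost x.
have [Ax|nAx] := pselect (A x); last have [Bx|nBx] := pselect (B x).
- have nBx := AB _ Ax; rewrite (transfer_add _ _ _ Ax nBx).
  rewrite !indicE (mem_set Ax) (memNset nBx) mulr1 mulr0 addr0.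
  have /andP[_ p_le] := p_slope _ _ (rho_ge0 x) s0.
  have : p1 x (rho x + s) <= p1 x (rho x + tau).
    by apply: (marginal_cost_homo (p_cost x)); rewrite ?addr_ge0// lerD2l.
  by have : p1 x (rho x + tau) + V x <= a := A_cheap _ Ax; nra.
- rewrite (transfer_remove _ _ _ nAx Bx) !indicE (memNset nAx) (mem_set Bx) mulr1 mulr0 addr0.
  have [/= rho_tau dear_b] := B_dear _ Bx.
  have rest_ge0 : 0 <= rho x - s' by lra.
  have /andP[p_ge _] := p_slope _ _ rest_ge0 s'0; rewrite subrK in p_ge.
  have : p1 x (Num.max (rho x - tau') 0) <= p1 x (rho x - s').
    apply: (marginal_cost_homo (p_cost x)); first by rewrite le_max lexx orbT.
    by rewrite max_l; lra.
  by nra.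
- by rewrite (transfer_id _ _ _ nAx nBx) !indicE !memNset// !mulr0 !addr0.
Qed.

Let integrand_ge0 (s : 'rV[R]_n -> R) x : (forall y, 0 <= s y) -> 0 <= p x (s x) + s x * V x.
Proof.
by move=> s0; rewrite addr_ge0 ?mulr_ge0// (convex_cost_ge0 (p_cost x)).
Qed.

Let measurable_integrand (s : 'rV[R]_n -> R) : measurable_fun setT s -> (forall y, 0 <= s y) ->
  measurable_fun setT (fun x => p x (s x) + s x * V x).
Proof.
by move=> ms s0; apply: measurable_funD; [exact: mp|exact: measurable_funM].
Qed.

Lemma transfer_gain_le0 A B r tau tau' a b s s' q : 0 <= a -> a < b ->
  0 <= s <= tau -> 0 <= s' <= tau' -> measurable A -> measurable B -> A `<=` eball 0 r ->
  A `<=` cheap tau a -> B `<=` dear tau' b ->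
  (s%:E * mu A = q%:E)%E -> (s'%:E * mu B = q%:E)%E -> q * b <= q * a.
Proof.
move=> a0 ab s_tau s'_tau mA mB A_r A_cheap B_dear massA massB.
have /andP[s0 _] := s_tau; have /andP[s'0 s'_le] := s'_tau.
pose sigma := transfer rho A B s s'.
have B_removable x : B x -> s' <= rho x.
  by move=> /B_dear[/= tau_le _]; exact: le_trans tau_le.
have sigmaP : P2dens sigma.
  by apply: (P2dens_transfer rhoP s0 s'0 mA mB A_r B_removable); rewrite massA massB.
have sigma_ge0 x := P2dens_ge0 x sigmaP.
have msigma := P2dens_measurable sigmaP.
have b0 : 0 <= b by exact/ltW/(le_lt_trans a0).
have qE k c C : 0 <= k -> 0 <= c -> measurable C -> (k%:E * mu C = q%:E)%E ->
    ((q * c)%:E = \int[mu]_x (k * c * \1_C x)%:E)%E.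
  move=> k0 c0 mC massC; rewrite integral_scaled_indic ?mulr_ge0//.
  by rewrite EFinM -massC muleAC -EFinM.
have gain : (J sigma + (q * b)%:E <= J rho + (q * a)%:E)%E.
  rewrite (qE _ _ _ s'0 b0 mB massB) (qE _ _ _ s0 a0 mA massA) -!ge0_integralD_EFin//;
    try (exact: measurable_integrand); try (exact: measurable_scaled_indic);
    try (by move=> x; exact: integrand_ge0); try (by move=> x; rewrite !mulr_ge0).
  apply: ge0_le_integral_EFin.
  - by apply: measurable_funD; [exact: measurable_integrand|exact: measurable_scaled_indic].
  - by apply: measurable_funD; [exact: measurable_integrand|exact: measurable_scaled_indic].
  - by move=> x; rewrite addr_ge0 ?integrand_ge0// !mulr_ge0.
  - by move=> x; exact: (transfer_cost_le x ab s_tau s'_tau A_cheap B_dear).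
have Jrho_fin : J rho \is a fin_num.
  by rewrite ge0_fin_numE//; apply: integral_EFin_ge0 => x; exact: integrand_ge0.
rewrite -lee_fin -(leeD2lE _ _ Jrho_fin); apply: le_trans gain.
by rewrite leeD2r// J_min.
Qed.

Lemma cheap_dear_null A B r r' tau tau' a b : a < b -> 0 < tau -> 0 < tau' ->
  measurable A -> measurable B -> A `<=` eball 0 r -> B `<=` eball 0 r' ->
  A `<=` cheap tau a -> B `<=` dear tau' b -> mu A = 0%E \/ mu B = 0%E.
Proof.
move=> ab tau0 tau'0 mA mB A_r B_r' A_cheap B_dear.
have [->|A_neq0] := eqVneq (mu A) 0%E; first by left.
have [->|B_neq0] := eqVneq (mu B) 0%E; [by right|exfalso].
have positive_mass C t : measurable C -> C `<=` eball 0 t -> mu C != 0%E ->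
    exists2 v : R, 0 < v & mu C = v%:E.
  move=> mC C_t C_neq0; have C_fin : mu C \is a fin_num.
    by rewrite ge0_fin_numE// (leb_sub_eball_lty mC C_t).
  by exists (fine (mu C)); rewrite ?fineK// -lte_fin fineK// lt0e C_neq0 measure_ge0.
have [vA vA0 muA] := positive_mass _ _ mA A_r A_neq0.
have [vB vB0 muB] := positive_mass _ _ mB B_r' B_neq0.
have a0 : 0 <= a.
  have /set0P[x Ax] : A != set0 by apply: contraNneq A_neq0 => ->; rewrite measure0.
  apply: le_trans (A_cheap _ Ax); rewrite addr_ge0//.
  by rewrite (marginal_cost_ge0 (p_cost x))// addr_ge0// ltW.
pose c := Num.min (tau / vB) (tau' / vA).
have c0 : 0 < c by rewrite lt_min !divr_gt0.
have s_tau : 0 <= c * vB <= tau.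
  by apply/andP; split; [rewrite mulr_ge0// ltW|rewrite -ler_pdivlMr// ge_min lexx].
have s'_tau' : 0 <= c * vA <= tau'.
  by apply/andP; split; [rewrite mulr_ge0// ltW|rewrite -ler_pdivlMr// ge_min lexx orbT].
have : c * vA * vB * b <= c * vA * vB * a.
  apply: (transfer_gain_le0 a0 ab s_tau s'_tau' mA mB A_r A_cheap B_dear).
    by rewrite muA -EFinM mulrAC.
  by rewrite muB -EFinM.
by rewrite ler_pM2l ?mulr_gt0// leNgt ab.
Qed.

Lemma marginal_lt_cheap a x : marginal x < a ->
  \forall k \near \oo, cheap k.+1%:R^-1 a x.
Proof.
rewrite -subr_gt0 => gap0.
apply: filterS (marginal_cost_near (p_cost x) (rho_ge0 x) gap0) => k close.
have : `|p1 x (rho x + k.+1%:R^-1) - p1 x (rho x)| < a - marginal x.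
  by apply: close; rewrite ?addr_ge0 ?invr_ge0// addrAC subrr add0r ger0_norm ?invr_ge0.
by rewrite ltr_norml /marginal /cheap/= => /andP[_]; lra.
Qed.

Lemma marginal_gt_dear b x : 0 < rho x -> b < marginal x ->
  \forall k \near \oo, dear k.+1%:R^-1 b x.
Proof.
move=> rho0; rewrite -subr_gt0 => gap0.
apply: filterS2 (marginal_cost_near (p_cost x) (rho_ge0 x) gap0)
  (near_infty_natSinv_lt (PosNum rho0)) => k close /= /ltW tau_le.
have rest_ge0 : 0 <= rho x - k.+1%:R^-1 by rewrite subr_ge0.
have : `|p1 x (rho x - k.+1%:R^-1) - p1 x (rho x)| < marginal x - b.
  by apply: close; rewrite // addrAC subrr add0r normrN ger0_norm ?invr_ge0.
rewrite ltr_norml /marginal => /andP[cost_gt _].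
by split=> //=; rewrite max_l//; lra.
Qed.

Lemma ae_marginal_dichotomy a b : a < b ->
  (\forall x \ae mu, a <= marginal x) \/
  (\forall x \ae mu, 0 < rho x -> marginal x <= b).
Proof.
move=> ab; have tau0 k : 0 < k.+1%:R^-1 :> R by rewrite invr_gt0.
have mcheap k : measurable (cheap k.+1%:R^-1 a) by apply: measurable_cheap; exact: ltW.
have mdear k : measurable (dear k.+1%:R^-1 b) by exact: measurable_dear.
have [cheap0|/existsNP[k /eqP cheap_neq0]] :=
  pselect (forall k, mu (cheap k.+1%:R^-1 a `&` eball 0 k.+1%:R) = 0%E).
  left; apply: ae_exhaustion mcheap cheap0 => x /negP.
  by rewrite -ltNge => /marginal_lt_cheap.
right; apply: (ae_exhaustion _ mdear) => [x /not_implyP[rho0 /negP]|l].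
  by rewrite -ltNge => /(marginal_gt_dear rho0).
have mbounded (C : set 'rV[R]_n) m : measurable C -> measurable (C `&` eball 0 m.+1%:R).
  by move=> mC; apply: measurableI => //; exact: measurable_eball.
have [] // := cheap_dear_null (r := k.+1%:R) (r' := l.+1%:R) ab (tau0 k) (tau0 l)
  (mbounded _ k (mcheap k)) (mbounded _ l (mdear l)).
by move=> cheap0; rewrite cheap0 eqxx in cheap_neq0.
Qed.

Lemma exists_multiplier : exists C, (\forall x \ae mu, C <= marginal x) /\
  (\forall x \ae mu, 0 < rho x -> marginal x <= C).
Proof.
pose S := [set a | \forall x \ae mu, a <= marginal x].
have S0 : S !=set0 by exists 0; apply: aeW => x; exact: marginal_ge0.
have S_bounded : has_ubound S.
  apply: contrapT => /forallNP S_unbounded.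
  have ae_large (k : nat) : \forall x \ae mu, k%:R <= marginal x.
    have /existsNP[a /not_implyP[Sa /negP]] := S_unbounded k%:R.
    by rewrite -ltNge => /ltW ka; apply: filterS Sa => x; exact: le_trans.
  have [|x _ x_large] := ae_open_meets openT _ (ae_foralln ae_large).
    by exists 0.
  have := truncnS_gt (marginal x).
  by rewrite ltNge x_large.
have S_sup : has_sup S by [].
exists (sup S); split.
  have ae_close (k : nat) : \forall x \ae mu, sup S <= marginal x + k.+1%:R^-1.
    have [|a Sa supa] := sup_adherent (_ : 0 < k.+1%:R^-1) S_sup; first by rewrite invr_gt0.
    by apply: filterS Sa => x ax; rewrite -lerBlDr (le_trans (ltW supa)).
  by apply: filterS (ae_foralln ae_close) => x; exact: le_addSinv.
have ae_close e : 0 < e -> \forall x \ae mu, 0 < rho x -> marginal x <= sup S + e.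
  move=> e0; have half_lt : sup S + e / 2 < sup S + e by lra.
  have [Sa|//] := ae_marginal_dichotomy half_lt.
  by have := sup_upper_bound S_sup Sa; lra.
have tau0 k : 0 < k.+1%:R^-1 :> R by rewrite invr_gt0.
apply: filterS (ae_foralln (fun k => ae_close _ (tau0 k))) => x close_x rho0.
by apply: le_addSinv => k; exact: close_x.
Qed.

Lemma euler_lagrange : exists2 C, 0 < C &
  \forall x \ae mu, p1 x (rho x) = Num.max (C - V x) 0.
Proof.
have [C [C_le marginal_le]] := exists_multiplier; exists C.
  rewrite ltNge; apply/negP => C0; apply: (P2dens_not_ae0 rhoP).
  apply: filterS marginal_le => x x_le; apply/eqP; rewrite eq_le rho_ge0 andbT leNgt.
  apply/negP => rho0; have := marginal_cost_gt0 (p_cost x) rho0.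
  by have := x_le rho0; have := V_ge0 x; rewrite /marginal; lra.
apply: filterS2 C_le marginal_le => x; rewrite /marginal => x_ge x_le.
have [rho0|] := ltP 0 (rho x).
  have := x_le rho0; have := marginal_cost_gt0 (p_cost x) rho0.
  by move=> ? ?; rewrite max_l; lra.
rewrite le_eqVlt ltNge rho_ge0 orbF => /eqP rho0; move: x_ge; rewrite rho0.
by have [_ -> _ _ _] := p_cost x => x_ge; rewrite max_r//; lra.
Qed.

End EulerLagrange.

(** * Supports and sublevel sets *)

Section Sublevel.
Context {R : realType} {n : nat}.
Implicit Types (x y : 'rV[R]_n) (V rho : 'rV[R]_n -> R).

Lemma sublevel_convex V C : convex_function setT V -> convex_set_rV [set x | V x <= C].
Proof.
move=> /convex_functionP cvxV x y /= Vx Vy t t01.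
by apply: (le_trans (cvxV x y t I I t01)); case/andP: t01; nra.
Qed.

Lemma sublevel_compact V C : continuous V -> quadratically_coercive V ->
  compact [set x | V x <= C].
Proof.
move=> contV [A [B [A0 V_coercive]]]; apply: bounded_closed_compact; last first.
  by apply: (closed_comp _ (@closed_le _ C)) => x _; exact: contV.
pose Q := (C + B) / A.
exists (`|Q| + 1); split=> [|M QM x /= VC]; first exact: num_real.
apply: le_trans (ltW QM); have xQ : `|x| ^+ 2 <= Q.
  apply: (@le_trans _ _ (enorm x ^+ 2)).
    by rewrite ler_pXn2r ?nnegrE ?enorm_ge0// normr_le_enorm.
  by rewrite ler_pdivlMr// mulrC; have := V_coercive x; lra.
by have := ler_norm Q; have := normr_ge0 x; nra.
Qed.

Lemma eball_meets_strict_sublevel V C x y r : convex_function setT V -> V x <= C -> V y < C ->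
  0 < r -> exists z, eball x r z /\ V z < C.
Proof.
move=> /convex_functionP cvxV VxC VyC r0.
have dist0 : 0 < enorm (y - x) + 1 by rewrite ltr_wpDl// enorm_ge0.
pose t := Num.min 1 (r / 2 / (enorm (y - x) + 1)).
have t0 : 0 < t by rewrite lt_min ltr01 !divr_gt0.
have t1 : t <= 1 by rewrite ge_min lexx.
exists (t *: y + (1 - t) *: x); split; last first.
  by apply: le_lt_trans (cvxV y x t I I _) _; [rewrite ltW|nra].
rewrite /eball/= scalerBl scale1r addrA addrAC addrK -scalerBr enormZ gtr0_norm//.
have : t * (enorm (y - x) + 1) <= r / 2 by rewrite -ler_pdivlMr// ge_min lexx orbT.
by have := enorm_ge0 (y - x); lra.
Qed.

Lemma supp_densP rho x : P2dens rho -> supp_dens rho x <->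
  forall r, 0 < r -> ~ \forall y \ae leb n, eball x r y -> rho y = 0.
Proof.
move=> rhoP; have rho_ge0 y : 0 <= rho y by exact: P2dens_ge0.
suff positive_mass r : (0 < iint (fun y => (rho y * \1_(eball x r) y)%:E))%E <->
    ~ \forall y \ae leb n, eball x r y -> rho y = 0.
  by split=> supp r r0; apply/positive_mass; exact: supp.
have mind : measurable_fun setT (fun y => rho y * (\1_(eball x r) y : R)).
  apply: measurable_funM; first exact: P2dens_measurable.
  by apply: measurable_indic; exact: measurable_eball.
have ind_ge0 y : 0 <= rho y * (\1_(eball x r) y : R) by rewrite mulr_ge0.
rewrite iint_EFin// lt0e integral_EFin_ge0// andbT.
have indE y : rho y * (\1_(eball x r) y : R) = 0 <-> (eball x r y -> rho y = 0).
  rewrite indicE; have [/set_mem xy|/negP xy] := boolP (y \in eball x r).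
    by rewrite mulr1; split=> // /(_ xy).
  by rewrite mulr0; split=> // _ /mem_set.
split=> [/eqP int_neq0 rho0|not_ae0]; last (apply/eqP; apply: contra_not not_ae0).
  by apply/int_neq0/ge0_integral_EFin_eq0P => //; apply: filterS rho0 => y /indE.
by move/(ge0_integral_EFin_eq0P _ mind ind_ge0); apply: filterS => y /indE.
Qed.

Lemma supp_dens_sublevel V rho C : P2dens rho -> continuous V -> convex_function setT V ->
  (\forall x \ae leb n, 0 < rho x <-> V x < C) -> supp_dens rho = [set x | V x <= C].
Proof.
move=> rhoP contV cvxV rho_pos; have rho_ge0 x : 0 <= rho x by exact: P2dens_ge0.
have rho0 x : 0 < rho x <-> V x < C -> C <= V x -> rho x = 0.
  by move=> pos; rewrite leNgt => /negP/(contra_not pos.1)/negP; rewrite -leNgt => ?;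
    apply/eqP; rewrite eq_le rho_ge0 andbT.
apply/seteqP; split=> x; rewrite (supp_densP _ rhoP)/=.
  move=> x_supp; rewrite leNgt; apply/negP => CV.
  have /nbhs_ballP[r /= r0 rC] : \forall y \near x, C < V y by exact: cvgr_gt (contV x) _ CV.
  apply: (x_supp r r0); apply: filterS rho_pos => y pos /eball_sub_ball/rC/ltW.
  exact: rho0.
move=> VC r r0 vanish.
have [y VyC] : exists y, V y < C.
  apply: contrapT => /forallNP VC_none; apply: (P2dens_not_ae0 rhoP).
  by apply: filterS rho_pos => y /rho0; apply; rewrite leNgt; apply/negP.
have [||z [zx VzC] [pos zero]] :=
  @ae_open_meets _ _ _ (eball x r `&` [set z | V z < C]) _ _ (filterI rho_pos vanish).
- apply: openI; first exact: open_eball.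
  by apply: (open_comp _ (@open_lt _ C)) => z _; exact: contV.
- by have [z [zx VzC]] := eball_meets_strict_sublevel cvxV VC VyC r0; exists z.
- by have := pos.2 VzC; rewrite zero// ltxx.
Qed.

End Sublevel.

(** * Convexity of the internal energy in one variable *)

Lemma continuous_within_comp (T U W : topologicalType) (A : set T) (B : set U)
    (f : T -> U) (g : U -> W) : (forall x, A x -> B (f x)) ->
  {within A, continuous f} -> {within B, continuous g} -> {within A, continuous (g \o f)}.
Proof.
move=> AB /subspace_continuousP cf /subspace_continuousP cg.
apply/subspace_continuousP => x Ax; apply: cvg_comp (cg _ (AB _ Ax)) => P /= BP.
have near_BP : \forall y \near x, A y -> B (f y) -> P (f y) := cf x Ax _ BP.
suff : \forall y \near x, A y -> P (f y) by [].
by apply: filterS near_BP => y BPy Ay; exact: BPy (AB _ Ay).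
Qed.

Lemma continuous_pair (T U W : topologicalType) (f : T -> U) (g : T -> W) :
  continuous f -> continuous g -> continuous (fun x => (f x, g x)).
Proof.
move=> cf cg x.
by apply: (@cvg_pair _ _ _ (nbhs x) (nbhs _) (nbhs _)); [exact: cf|exact: cg].
Qed.

Section HalfLine.
Context {R : realType}.
Implicit Types f g q : R -> R.

Lemma within_continuousZ (T : topologicalType) (A : set T) (k : R) (f : T -> R) :
  {within A, continuous f} -> {within A, continuous (fun x => k * f x)}.
Proof. by move=> cf x; apply: cvgMl_tmp; exact: cf. Qed.

Lemma half_line_MVT f f1 r s : {within [set r | 0 <= r], continuous f} ->
  (forall t : R, 0 < t -> is_derive t 1 f (f1 t)) -> 0 <= r -> r < s ->
  exists2 c, r < c < s & f s - f r = f1 c * (s - r).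
Proof.
move=> cf df r0 rs; have [t|| c crs fE] := @MVT _ f f1 r s rs.
- by rewrite in_itv/= => /andP[rt _]; apply: df; exact: le_lt_trans rt.
- apply: continuous_subspaceW cf => t; rewrite /= in_itv/= => /andP[rt _].
  exact: le_trans rt.
- by exists c; rewrite // -[_ && _]in_itv.
Qed.

Lemma convex_increment_le (D : set R^o) q r s d : convex_function D q -> D r -> D s ->
  r < s -> 0 <= d <= s - r -> q (r + d) - q r <= q s - q (s - d).
Proof.
move=> /convex_functionP cvxq Dr Ds rs /andP[d0 d_le].
have sr0 : 0 < s - r by rewrite subr_gt0.
pose t := d / (s - r); have tE : t * (s - r) = d by rewrite divfK// gt_eqF.
have t01 : 0 <= t <= 1 by rewrite divr_ge0 ?ler_pdivrMr ?mul1r// ltW.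
have := cvxq s r t Ds Dr t01; have := cvxq r s t Dr Ds t01.
rewrite /GRing.scale/= (_ : t * r + (1 - t) * s = s - d); last by rewrite -tE; ring.
rewrite (_ : t * s + (1 - t) * r = r + d); last by rewrite -tE; ring.
lra.
Qed.

(* Comparing increments near both ends also covers the endpoint [r = 0], where [q] has
   no two-sided derivative. *)
Lemma convex_derive_le q q1 r s : {within [set r | 0 <= r], continuous q} ->
  {within [set r | 0 <= r], continuous q1} ->
  (forall t : R, 0 < t -> is_derive t 1 q (q1 t)) ->
  convex_function [set r : R^o | 0 <= r] q -> 0 <= r -> r < s -> q1 r <= q1 s.
Proof.
move=> cq cq1 dq cvxq r0 rs; have s0 : 0 <= s by lra.
apply/ler_addgt0Pr => e e0; have e20 : 0 < e / 2 by rewrite divr_gt0.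
have [d1 d10 near_r] := within_half_line_dist cq1 r0 e20.
have [d2 d20 near_s] := within_half_line_dist cq1 s0 e20.
pose d := Num.min (Num.min d1 d2) (s - r).
have d0 : 0 < d by rewrite !lt_min d10 d20 subr_gt0.
have dd1 : d <= d1 by rewrite !ge_min lexx.
have dd2 : d <= d2 by rewrite !ge_min lexx orbT.
have dsr : d <= s - r by rewrite ge_min lexx orbT.
have [c /andP[rc cd] incr_r] : exists2 c, r < c < r + d & q (r + d) - q r = q1 c * (r + d - r).
  by apply: (half_line_MVT cq dq r0); rewrite ltrDl.
have [c' /andP[c's sc'] incr_s] :
    exists2 c, s - d < c < s & q s - q (s - d) = q1 c * (s - (s - d)).
  by apply: (half_line_MVT cq dq); rewrite ?gtrBl// subr_ge0 (le_trans dsr)// gerBl.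
have c_near : `|q1 c - q1 r| < e / 2.
  apply: near_r; first exact: ltW (le_lt_trans r0 rc).
  by rewrite gtr0_norm ?subr_gt0// (lt_le_trans _ dd1)// ltrBlDl.
have c'_near : `|q1 c' - q1 s| < e / 2.
  apply: near_s; first by apply: ltW (le_lt_trans _ c's); rewrite subr_ge0 (le_trans dsr)// gerBl.
  by rewrite distrC gtr0_norm ?subr_gt0// (lt_le_trans _ dd2)// ltrBlDl -ltrBlDr.
have slope_le : q1 c <= q1 c'.
  rewrite -(ler_pM2r d0); have := @convex_increment_le _ q r s d cvxq r0 s0 rs.
  rewrite (ltW d0) dsr => /(_ isT); rewrite incr_r incr_s.
  by rewrite subKr (addrAC r) subrr add0r.
by move: c_near c'_near; rewrite !ltr_norml => /andP[? _] /andP[_ ?]; lra.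
Qed.

Lemma derive_homo_slope f f1 : {within [set r | 0 <= r], continuous f} ->
  (forall t : R, 0 < t -> is_derive t 1 f (f1 t)) ->
  (forall r s, 0 <= r -> r < s -> f1 r <= f1 s) ->
  forall r s, 0 <= r -> 0 <= s -> s * f1 r <= f (r + s) - f r <= s * f1 (r + s).
Proof.
move=> cf df f1_homo r s r0; rewrite le_eqVlt => /predU1P[<-|s0].
  by rewrite addr0 !mul0r subrr lexx.
have rrs : r < r + s by rewrite ltrDl.
have [c /andP[rc cs] ->] := half_line_MVT cf df r0 rrs.
rewrite addrAC subrr add0r !(mulrC s) !ler_pM2r// !f1_homo//.
exact: ltW (le_lt_trans r0 rc).
Qed.

Lemma Fhyp_derive_incr (F dF d2F : R -> R) r s : Fhyp F dF d2F -> 0 <= r -> r < s -> dF r < dF s.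
Proof.
move=> [[derF _ cdF _] _ d2F_gt0 _ _] r0 rs.
have [c /andP[rc _] dFE] := half_line_MVT cdF (fun t t0 => (derF t t0).2) r0 rs.
by rewrite -subr_gt0 dFE mulr_gt0 ?subr_gt0// d2F_gt0// (le_lt_trans r0).
Qed.

Lemma convex_costDr f f1 c : 0 <= c -> convex_cost f f1 -> convex_cost (fun r => f r + c) f1.
Proof.
move=> c0 [f_ge0 f1_0 f1_cont f1_incr f_slope].
split=> // [r r0|r s r0 s0]; first by rewrite addr_ge0// f_ge0.
by rewrite opprD addrACA subrr addr0; exact: f_slope.
Qed.

Section Perturbation.
Variables (F dF d2F g g1 : R -> R) (eps0 eps : R).
Hypothesis F_hyp : Fhyp F dF d2F.
Hypothesis g_cont : {within [set r | 0 <= r], continuous g}.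
Hypothesis g1_cont : {within [set r | 0 <= r], continuous g1}.
Hypothesis g_derive : forall r : R, 0 < r -> is_derive r 1 g (g1 r).
Hypotheses (g_0 : g 0 = 0) (g1_0 : g1 0 = 0).
Hypothesis eps_bnd : 0 < eps <= eps0.
Hypothesis cvx : convex_function [set r : R^o | 0 <= r] (fun r => F r + 2 * eps0 * g r).

Let perturbed_cont k : {within [set r | 0 <= r], continuous (fun r => F r + k * g r)}.
Proof.
have [[_ F_cont _ _] _ _ _ _] := F_hyp.
by apply: (within_continuousD F_cont); exact: within_continuousZ.
Qed.

Let perturbed_derive_cont k :
  {within [set r | 0 <= r], continuous (fun r => dF r + k * g1 r)}.
Proof.
have [[_ _ dF_cont _] _ _ _ _] := F_hyp.
by apply: (within_continuousD dF_cont); exact: within_continuousZ.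
Qed.

Let perturbed_derive k (r : R) : 0 < r ->
  is_derive r 1 (fun r => F r + k * g r) (dF r + k * g1 r).
Proof.
have [[F_derive _ _ _] _ _ _ _] := F_hyp; move=> r0; have [dFr _] := F_derive r r0.
by apply: is_deriveD; exact: (is_deriveZ k (g_derive r0)).
Qed.

(* Up to the positive factor [2 * eps0], the increment of [dF + eps * g1] is [eps]
   times that of the derivative of a convex function plus [2 * eps0 - eps] times that
   of [dF], which is positive. *)
Lemma perturbed_derive_incr r s : 0 <= r -> r < s -> dF r + eps * g1 r < dF s + eps * g1 s.
Proof.
move=> r0 rs; have /andP[eps_gt0 eps_le] := eps_bnd.
have cvx_part : 0 <= eps * (dF s + 2 * eps0 * g1 s - (dF r + 2 * eps0 * g1 r)).
  rewrite mulr_ge0 ?subr_ge0//; first exact: ltW.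
  exact: (convex_derive_le (@perturbed_cont (2 * eps0)) (@perturbed_derive_cont (2 * eps0))
    (@perturbed_derive (2 * eps0)) cvx r0 rs).
have strict_part : 0 < (2 * eps0 - eps) * (dF s - dF r).
  by rewrite mulr_gt0 ?subr_gt0 ?(Fhyp_derive_incr F_hyp r0 rs)//; lra.
have eps00 : 0 < 2 * eps0 by lra.
by rewrite -subr_gt0 -(pmulr_rgt0 _ eps00); lra.
Qed.

Lemma perturbed_convex_cost :
  convex_cost (fun r => F r + eps * g r) (fun r => dF r + eps * g1 r).
Proof.
have [_ _ _ [F_0 dF_0] _] := F_hyp.
have slope := derive_homo_slope (@perturbed_cont eps) (@perturbed_derive eps)
  (fun r s r0 rs => ltW (perturbed_derive_incr r0 rs)).
split=> //.
- move=> r r0; have /andP[+ _] := slope 0 r (lexx 0) r0.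
  by rewrite dF_0 g1_0 F_0 g_0 !mulr0 !addr0 mulr0 add0r subr0.
- by rewrite dF_0 g1_0 mulr0 addr0.
- exact: perturbed_derive_incr.
Qed.

End Perturbation.

End HalfLine.

Section Quadrant.
Context {R : realType}.

(* Continuity gives measurability for the Borel sets of row vectors, not directly for the
   product sigma-algebra of the plane. *)
Lemma within_quadrant_measurable d (T : measurableType d) (G : R -> R -> R) (u v : T -> R) :
  {within quadrant, continuous (fun p : R * R => G p.1 p.2)} ->
  measurable_fun setT u -> measurable_fun setT v ->
  (forall x, 0 <= u x) -> (forall x, 0 <= v x) ->
  measurable_fun setT (fun x => G (u x) (v x)).
Proof.
move=> cG meas_u meas_v u0 v0.
pose i0 : 'I_2 := ord0; pose i1 : 'I_2 := ord_max.
pose quadrant_rV := [set y : 'rV[R]_2 | 0 <= y ord0 i0] `&` [set y | 0 <= y ord0 i1].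
pose row x : 'rV[R]_2 := \row_i (if i == i0 then u x else v x).
have row0 x : row x ord0 i0 = u x by rewrite mxE.
have row1 x : row x ord0 i1 = v x by rewrite mxE.
rewrite (_ : (fun x => _) = (fun y : 'rV[R]_2 => G (y ord0 i0) (y ord0 i1)) \o row); last first.
  by apply/funext => x; rewrite /= row0 row1.
have mquadrant : measurable quadrant_rV.
  by apply: measurableI; apply: measurable_set_le => //; exact: measurable_coord_rV.
apply: (@measurable_comp _ _ _ _ _ _ quadrant_rV) => //.
- by move=> _ [x _ <-]; split; rewrite /= ?row0 ?row1.
- apply: within_continuous_measurable_rV => //.
  apply: (continuous_within_comp (f := fun y : 'rV[R]_2 => (y ord0 i0, y ord0 i1)) _ _ cG).
    by move=> y [].
  by apply: continuous_subspaceT; apply: continuous_pair; exact: coord_continuous.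
- apply: measurable_fun_rV => i; under eq_fun do rewrite mxE.
  by case: (i == i0).
Qed.

Lemma within_quadrant_slice (G : R -> R -> R) r2 :
  {within quadrant, continuous (fun p : R * R => G p.1 p.2)} -> 0 <= r2 ->
  {within [set r | 0 <= r], continuous (G ^~ r2)}.
Proof.
move=> cG r20; apply: (continuous_within_comp (f := fun r => (r, r2)) _ _ cG) => //.
apply: continuous_subspaceT; apply: continuous_pair => r; [exact: cvg_id|exact: cvg_cst].
Qed.

Lemma within_quadrant_swap (G : R -> R -> R) :
  {within quadrant, continuous (fun p : R * R => G p.1 p.2)} ->
  {within quadrant, continuous (fun p : R * R => G p.2 p.1)}.
Proof.
move=> cG; apply: (continuous_within_comp (f := fun p : R * R => (p.2, p.1)) _ _ cG).
  by move=> p [].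
apply: continuous_subspaceT; apply: continuous_pair => p; [exact: cvg_snd|exact: cvg_fst].
Qed.

Lemma within_quadrant_fst (f : R -> R) : {within [set r | 0 <= r], continuous f} ->
  {within quadrant, continuous (fun p : R * R => f p.1)}.
Proof.
apply: continuous_within_comp => [p []//|].
by apply: continuous_subspaceT => p; exact: cvg_fst.
Qed.

End Quadrant.

Section InternalEnergy.
Context {R : realType}.
Variables (F1 dF1 d2F1 F2 dF2 d2F2 : R -> R) (h h1 h2 h1_1 h1_2 h2_1 h2_2 : R -> R -> R).
Variables eps0 eps : R.

Definition internal_energy (r1 r2 : R) : R := F1 r1 + F2 r2 + eps * h r1 r2.

Hypotheses (F1_hyp : Fhyp F1 dF1 d2F1) (F2_hyp : Fhyp F2 dF2 d2F2).
Hypothesis h_hyp : hhyp h h1 h2 h1_1 h1_2 h2_1 h2_2.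
Hypothesis cvx : convex_quadrant (fun r1 r2 => F1 r1 + F2 r2 + 2 * eps0 * h r1 r2).
Hypothesis eps_bnd : 0 < eps <= eps0.

Let h_cont : {within quadrant, continuous (fun p : R * R => h p.1 p.2)}.
Proof. by have [_ all_cont _] := h_hyp; apply: all_cont; rewrite !inE eqxx. Qed.

Let h1_cont : {within quadrant, continuous (fun p : R * R => h1 p.1 p.2)}.
Proof. by have [_ all_cont _] := h_hyp; apply: all_cont; rewrite !inE eqxx orbT. Qed.

Lemma internal_energy_continuous :
  {within quadrant, continuous (fun p : R * R => internal_energy p.1 p.2)}.
Proof.
have [[_ F1_cont _ _] _ _ _ _] := F1_hyp; have [[_ F2_cont _ _] _ _ _ _] := F2_hyp.
have F2_snd_cont : {within quadrant, continuous (fun p : R * R => F2 p.2)}.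
  exact: (@within_quadrant_swap _ (fun r _ => F2 r) (within_quadrant_fst F2_cont)).
exact: (within_continuousD (within_continuousD (within_quadrant_fst F1_cont) F2_snd_cont)
  (within_continuousZ h_cont)).
Qed.

Lemma internal_energy_derive_continuous :
  {within quadrant, continuous (fun p : R * R => dF1 p.1 + eps * h1 p.1 p.2)}.
Proof.
have [[_ _ dF1_cont _] _ _ _ _] := F1_hyp.
exact: (within_continuousD (within_quadrant_fst dF1_cont) (within_continuousZ h1_cont)).
Qed.

Lemma hhyp_derive_slice r2 (r : R) : 0 <= r2 -> 0 < r ->
  is_derive r 1 (fun s => h s r2) (h1 r r2).
Proof.
have [h_derive _ h_vanish] := h_hyp.
rewrite le_eqVlt => /predU1P[<- r0|r20 r0]; last by have [] := h_derive r r2 r0 r20.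
have [_ -> _] := h_vanish r 0 (ltW r0) (lexx 0) (or_intror erefl).
apply: near_eq_is_derive (is_derive_cst (0 : R) r 1); near=> s.
have [|//] := h_vanish s 0 _ (lexx 0) (or_intror erefl).
by near: s; apply: filterS (lt_nbhsr r0) => s /ltW.
Unshelve. all: by end_near. Qed.

Lemma internal_energy_cost r2 : 0 <= r2 ->
  convex_cost (internal_energy ^~ r2) (fun r1 => dF1 r1 + eps * h1 r1 r2).
Proof.
move=> r20; have [_ _ h_vanish] := h_hyp; have [_ F2_ge0 _ _ _] := F2_hyp.
have [h_0 h1_0 _] := h_vanish 0 r2 (lexx 0) r20 (or_introl erefl).
rewrite (_ : internal_energy ^~ r2 = fun r1 => F1 r1 + eps * h r1 r2 + F2 r2); last first.
  by apply/funext => r1; rewrite /internal_energy addrAC.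
apply: convex_costDr; first exact: F2_ge0.
apply: perturbed_convex_cost F1_hyp _ _ _ h_0 h1_0 eps_bnd _.
- exact: within_quadrant_slice.
- exact: within_quadrant_slice.
- by move=> r r0; exact: hhyp_derive_slice.
- apply/convex_functionP => r s t r0 s0 t01; rewrite /GRing.scale/=.
  have := cvx r0 r20 s0 r20 t01.
  by rewrite (_ : t * r2 + (1 - t) * r2 = r2); [lra|ring].
Qed.

Lemma internal_energy00 : internal_energy 0 0 = 0.
Proof.
have [_ _ h_vanish] := h_hyp.
have [_ _ _ [F1_0 _] _] := F1_hyp; have [_ _ _ [F2_0 _] _] := F2_hyp.
have [h_0 _ _] := h_vanish 0 0 (lexx 0) (lexx 0) (or_introl erefl).
by rewrite /internal_energy F1_0 F2_0 h_0 mulr0 !addr0.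
Qed.

Lemma hhyp_swap : hhyp (fun r1 r2 => h r2 r1) (fun r1 r2 => h2 r2 r1) (fun r1 r2 => h1 r2 r1)
  (fun r1 r2 => h2_2 r2 r1) (fun r1 r2 => h2_1 r2 r1) (fun r1 r2 => h1_2 r2 r1)
  (fun r1 r2 => h1_1 r2 r1).
Proof.
have [h_derive h_continuous h_vanish] := h_hyp; split.
- by move=> r1 r2 r10 r20; have [? ? []] := h_derive r2 r1 r20 r10.
- move=> g g_in; apply: (@within_quadrant_swap _ (fun r1 r2 => g r2 r1)).
  apply: (h_continuous (fun r1 r2 => g r2 r1)); move: g_in; rewrite !inE.
  by do 6?[case/orP=> [/eqP->|]]; try (move=> /eqP->); rewrite eqxx ?orbT.
- move=> r1 r2 r10 r20 r12.
  by have [? ? ?] := h_vanish r2 r1 r20 r10 ((or_comm _ _).1 r12).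
Qed.

Lemma convex_quadrant_swap :
  convex_quadrant (fun r1 r2 => F2 r1 + F1 r2 + 2 * eps0 * h r2 r1).
Proof.
move=> r1 r2 s1 s2 t r10 r20 s10 s20 t01.
by have := cvx r20 r10 s20 s10 t01; lra.
Qed.

End InternalEnergy.

(** * The energy and its minimizers *)

Section UniformDensity.
Context {R : realType} {n : nat}.
Local Notation mu := (@leb R n).

Definition uniform_density (A : set 'rV[R]_n) x : R := (fine (mu A))^-1 * \1_A x.

Lemma P2dens_uniform (A : set 'rV[R]_n) r : measurable A -> A `<=` eball 0 r ->
  (0 < mu A)%E -> P2dens (uniform_density A).
Proof.
move=> mA A_r A0; have A_fin : mu A \is a fin_num.
  by rewrite ge0_fin_numE// (leb_sub_eball_lty mA A_r).
have v0 : 0 < fine (mu A) by rewrite -lte_fin fineK.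
have vV0 : 0 <= (fine (mu A))^-1 by rewrite invr_ge0 ltW.
apply/P2densP; split.
- exact: measurable_scaled_indic.
- by move=> x; rewrite mulr_ge0.
- by rewrite integral_scaled_indic// -[X in (_ * X)%E]fineK// -EFinM mulVf// gt_eqF.
- exact: moment_scaled_indic_lty A_r.
Qed.

End UniformDensity.

Section Energy.
Context {R : realType} {n : nat}.
Local Notation mu := (@leb R n).

Lemma L1_Rint_ge0 (f : 'rV[R]_n -> R) : measurable_fun setT f -> (forall x, 0 <= f x) ->
  (if pselect (Defs.L1 f) then (Defs.Rint f)%:E else +oo%E) = (\int[mu]_x (f x)%:E)%E.
Proof.
move=> mf f0; have absE : (fun x => (`|f x|)%:E) = (fun x => (f x)%:E).
  by apply/funext => x; rewrite ger0_norm.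
case: pselect => [[_]|not_L1] /=; last first.
  apply/esym/eqP; rewrite -leye_eq leNgt; apply/negP => f_fin; apply: not_L1.
  by split; [exact/borel_funP|rewrite absE iint_EFin].
rewrite absE iint_EFin// => f_fin.
have posE : (fun x => (Num.max (f x) 0)%:E) = (fun x => (f x)%:E).
  by apply/funext => x; rewrite max_l.
have negE : (fun x => (Num.max (- f x) 0)%:E) = (fun x => (0 : R)%:E).
  by apply/funext => x; rewrite max_r// oppr_le0.
rewrite /Defs.Rint posE negE !iint_EFin// integral0 subr0 fineK// ge0_fin_numE//.
exact: integral_EFin_ge0.
Qed.

Variables (K : 'rV[R]_n -> R) (P : R -> R -> R).
Hypothesis K_confining : confining_kernel K.
Hypothesis P_cont : {within quadrant, continuous (fun p : R * R => P p.1 p.2)}.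
Hypothesis P_ge0 : forall r1 r2, 0 <= r1 -> 0 <= r2 -> 0 <= P r1 r2.
Implicit Types s : 'rV[R]_n -> R.

Definition total_energy s1 s2 : \bar R :=
  (\int[mu]_x (P (s1 x) (s2 x) + s1 x * convol K s2 x)%:E)%E.

Lemma measurable_local_energy s1 s2 : P2dens s1 -> P2dens s2 ->
  measurable_fun setT (fun x => P (s1 x) (s2 x)).
Proof.
move=> s1P s2P; apply: within_quadrant_measurable => //;
  by [exact: P2dens_measurable|move=> x; exact: P2dens_ge0].
Qed.

Lemma measurable_interaction s1 s2 : P2dens s1 -> P2dens s2 ->
  measurable_fun setT (fun x => s1 x * convol K s2 x).
Proof.
move=> s1P s2P; apply: measurable_funM; first exact: P2dens_measurable.
exact: measurable_convol.
Qed.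

Lemma local_energy_ge0 s1 s2 x : P2dens s1 -> P2dens s2 -> 0 <= P (s1 x) (s2 x).
Proof. by move=> s1P s2P; apply: P_ge0; exact: P2dens_ge0. Qed.

Lemma interaction_ge0 s1 s2 x : P2dens s1 -> P2dens s2 -> 0 <= s1 x * convol K s2 x.
Proof. by move=> s1P s2P; rewrite mulr_ge0 ?(P2dens_ge0 _ s1P)// convol_ge0. Qed.

Lemma L1_Rint_total_energy s1 s2 : P2dens s1 -> P2dens s2 ->
  let f x := P (s1 x) (s2 x) + s1 x * convol K s2 x in
  (if pselect (Defs.L1 f) then (Defs.Rint f)%:E else +oo%E) = total_energy s1 s2.
Proof.
move=> s1P s2P; apply: L1_Rint_ge0 => [|x].
  by apply: measurable_funD; [exact: measurable_local_energy|exact: measurable_interaction].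
by rewrite addr_ge0 ?local_energy_ge0 ?interaction_ge0.
Qed.

Lemma finite_energy_exists : P 0 0 = 0 -> exists2 s, P2dens s & (total_energy s s < +oo)%E.
Proof.
move=> P00; pose B : set 'rV[R]_n := eball 0 1.
have mB : measurable B by exact: measurable_eball.
have sP : P2dens (uniform_density B).
  apply: (@P2dens_uniform _ _ _ 1) => //; apply: leb_open_gt0; first exact: open_eball.
  by exists 0; rewrite /B /eball/= subr0 -(scale0r 0) enormZ normr0 mul0r.
exists (uniform_density B) => //; set s := uniform_density B in sP *.
pose v := (fine (mu B))^-1; have v0 : 0 <= v by rewrite invr_ge0 fine_ge0.
have [A [D [A0 D0 V_le]]] := convol_quadratic_le K_confining sP.
pose M := P v v + v * (A + D).
have M0 : 0 <= M by rewrite addr_ge0 ?P_ge0// mulr_ge0// addr_ge0.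
apply: (@le_lt_trans _ _ (\int[mu]_x (M * \1_B x)%:E)%E); last first.
  rewrite integral_scaled_indic// lte_mul_pinfty//.
  exact: (@leb_sub_eball_lty _ _ _ 0 1).
apply: ge0_le_integral_EFin; last move=> x.
- by apply: measurable_funD; [exact: measurable_local_energy|exact: measurable_interaction].
- exact: measurable_scaled_indic.
- by move=> x; rewrite addr_ge0 ?local_energy_ge0 ?interaction_ge0.
rewrite /s /uniform_density -/v indicE; have [/set_mem Bx|_] := boolP (x \in B); last first.
  by rewrite !mulr0 P00 mul0r addr0.
rewrite !mulr1 lerD2l ler_wpM2l// (le_trans (V_le x))// lerD2r ler_piMr//.
by move: Bx; rewrite /B /eball/= subr0 => x1; rewrite expr_le1 ?enorm_ge0 ?ltW.
Qed.

Section Component.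
Variables (P1 : R -> R -> R) (rho1 rho2 : 'rV[R]_n -> R).
Hypothesis P1_cont : {within quadrant, continuous (fun p : R * R => P1 p.1 p.2)}.
Hypothesis P_cost : forall r2, 0 <= r2 -> convex_cost (P ^~ r2) (P1 ^~ r2).
Hypotheses (rho1P : P2dens rho1) (rho2P : P2dens rho2).
Hypothesis energy_fin : (total_energy rho1 rho2 < +oo)%E.
Hypothesis energy_min : forall s, P2dens s -> (total_energy rho1 rho2 <= total_energy s rho2)%E.

Lemma component_euler_lagrange : exists2 C, 0 < C &
  \forall x \ae mu, P1 (rho1 x) (rho2 x) = Num.max (C - convol K rho2 x) 0.
Proof.
have rho2_ge0 x : 0 <= rho2 x by exact: P2dens_ge0.
have mrho2 := P2dens_measurable rho2P.
apply: (euler_lagrange (p := fun x r => P r (rho2 x)) (p1 := fun x r => P1 r (rho2 x))).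
- by move=> x; exact: P_cost.
- by move=> s ms s_ge0; exact: (within_quadrant_measurable P_cont).
- by move=> s ms s_ge0; exact: (within_quadrant_measurable P1_cont).
- exact: measurable_convol.
- by move=> x; exact: convol_ge0.
- exact: rho1P.
- exact: energy_fin.
- exact: energy_min.
Qed.

Lemma component_support C :
  (\forall x \ae mu, P1 (rho1 x) (rho2 x) = Num.max (C - convol K rho2 x) 0) ->
  supp_dens rho1 = [set x | convol K rho2 x <= C].
Proof.
move=> EL; apply: supp_dens_sublevel rho1P _ _ _.
- exact: convol_continuous.
- exact: convol_convex.
- apply: filterS EL => x.
  exact: (marginal_cost_pos (P_cost (P2dens_ge0 x rho2P)) (P2dens_ge0 x rho1P)).
Qed.

Lemma component_minimizer : exists C, [/\ 0 < C,
  ae_Rd (fun x => P1 (rho1 x) (rho2 x) = Num.max (C - convol K rho2 x) 0),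
  supp_dens rho1 = [set x | convol K rho2 x <= C],
  compact (supp_dens rho1) & convex_set_rV (supp_dens rho1)].
Proof.
have [C C0 EL] := component_euler_lagrange; have suppE := component_support EL.
exists C; split=> //; first exact/ae_RdP.
- by rewrite suppE; apply: sublevel_compact; [exact: convol_continuous|exact: convol_coercive].
- by rewrite suppE; apply: sublevel_convex; exact: convol_convex.
Qed.

End Component.

End Energy.

Lemma total_energy_swap {R : realType} n (K : 'rV[R]_n -> R) (P : R -> R -> R) s1 s2 :
  confining_kernel K -> {within quadrant, continuous (fun p : R * R => P p.1 p.2)} ->
  (forall r1 r2, 0 <= r1 -> 0 <= r2 -> 0 <= P r1 r2) -> P2dens s1 -> P2dens s2 ->
  total_energy K P s1 s2 = total_energy K (fun r1 r2 => P r2 r1) s2 s1.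
Proof.
move=> K_confining P_cont P_ge0 s1P s2P.
have mP := measurable_local_energy P_cont s1P s2P.
have m12 := measurable_interaction K_confining s1P s2P.
have m21 := measurable_interaction K_confining s2P s1P.
have P0 x := local_energy_ge0 P_ge0 x s1P s2P.
have i12 x := interaction_ge0 K_confining x s1P s2P.
have i21 x := interaction_ge0 K_confining x s2P s1P.
by rewrite /total_energy !ge0_integralD_EFin// (convol_interaction_sym K_confining s1P s2P).
Qed.

Section Minimizer.
Context {R : realType} {n : nat} (K : 'rV[R]_n -> R).
Variables (F1 dF1 d2F1 F2 dF2 d2F2 : R -> R) (h h1 h2 h1_1 h1_2 h2_1 h2_2 : R -> R -> R).
Variables eps0 eps : R.
Hypothesis K_confining : confining_kernel K.
Hypotheses (F1_hyp : Fhyp F1 dF1 d2F1) (F2_hyp : Fhyp F2 dF2 d2F2).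
Hypothesis h_hyp : hhyp h h1 h2 h1_1 h1_2 h2_1 h2_2.
Hypothesis cvx : convex_quadrant (fun r1 r2 => F1 r1 + F2 r2 + 2 * eps0 * h r1 r2).
Hypothesis eps_bnd : 0 < eps <= eps0.

Local Notation P := (internal_energy F1 F2 h eps).

Let P_cont := internal_energy_continuous F1_hyp F2_hyp h_hyp (eps := eps).
Let P_cost := internal_energy_cost F1_hyp F2_hyp h_hyp cvx eps_bnd.
Let P_ge0 r1 r2 : 0 <= r1 -> 0 <= r2 -> 0 <= P r1 r2.
Proof. by move=> r10 r20; exact: (convex_cost_ge0 (P_cost r20)). Qed.

Lemma energyE s1 s2 : P2dens s1 -> P2dens s2 ->
  energy K F1 F2 h eps s1 s2 = total_energy K P s1 s2.
Proof. exact: L1_Rint_total_energy. Qed.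

Lemma minimizer_first_component rho1 rho2 : P2dens rho1 -> P2dens rho2 ->
  (forall s1 s2, P2dens s1 -> P2dens s2 ->
     (energy K F1 F2 h eps rho1 rho2 <= energy K F1 F2 h eps s1 s2)%E) ->
  exists C, [/\ 0 < C,
    ae_Rd (fun x => dF1 (rho1 x) + eps * h1 (rho1 x) (rho2 x) = Num.max (C - convol K rho2 x) 0),
    supp_dens rho1 = [set x | convol K rho2 x <= C],
    compact (supp_dens rho1) & convex_set_rV (supp_dens rho1)].
Proof.
move=> rho1P rho2P energy_min.
have total_min s1 s2 : P2dens s1 -> P2dens s2 ->
    (total_energy K P rho1 rho2 <= total_energy K P s1 s2)%E.
  by move=> s1P s2P; rewrite -!energyE//; exact: energy_min.
have [s sP s_fin] := finite_energy_exists K_confining P_cont P_ge0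
  (internal_energy00 eps F1_hyp F2_hyp h_hyp).
apply: (component_minimizer K_confining P_cont
  (internal_energy_derive_continuous F1_hyp h_hyp) P_cost rho1P rho2P).
- by apply: le_lt_trans s_fin; exact: total_min.
- by move=> s1 s1P; exact: total_min.
Qed.

End Minimizer.

Lemma energy_swap {R : realType} n (K : 'rV[R]_n -> R)
  (F1 dF1 d2F1 F2 dF2 d2F2 : R -> R) (h h1 h2 h1_1 h1_2 h2_1 h2_2 : R -> R -> R)
  (eps0 eps : R) s1 s2 : confining_kernel K -> Fhyp F1 dF1 d2F1 -> Fhyp F2 dF2 d2F2 ->
  hhyp h h1 h2 h1_1 h1_2 h2_1 h2_2 ->
  convex_quadrant (fun r1 r2 => F1 r1 + F2 r2 + 2 * eps0 * h r1 r2) ->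
  0 < eps <= eps0 -> P2dens s1 -> P2dens s2 ->
  energy K F1 F2 h eps s1 s2 = energy K F2 F1 (fun r1 r2 => h r2 r1) eps s2 s1.
Proof.
move=> K_confining F1_hyp F2_hyp h_hyp cvx eps_bnd s1P s2P.
rewrite (energyE K_confining F1_hyp F2_hyp h_hyp cvx eps_bnd s1P s2P).
rewrite (energyE K_confining F2_hyp F1_hyp (hhyp_swap h_hyp) (convex_quadrant_swap cvx)
  eps_bnd s2P s1P) total_energy_swap//.
- congr total_energy; apply/funext => r1; apply/funext => r2.
  by rewrite /internal_energy (addrC (F1 _)).
- exact: internal_energy_continuous F1_hyp F2_hyp h_hyp.
- move=> r1 r2 r10 r20.
  exact: (convex_cost_ge0 (internal_energy_cost F1_hyp F2_hyp h_hyp cvx eps_bnd r20)).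
Qed.

Theorem theorem3p8 (R : realType) (d : nat) (hd : (1 <= d)%N)
  (K : 'rV[R]_d -> R)
  (F1 dF1 d2F1 F2 dF2 d2F2 : R -> R)
  (h h1 h2 h1_1 h1_2 h2_1 h2_2 : R -> R -> R)
  (eps0 eps : R) :
  Khyp K ->
  Fhyp F1 dF1 d2F1 -> Fhyp F2 dF2 d2F2 ->
  hhyp h h1 h2 h1_1 h1_2 h2_1 h2_2 ->
  theta_ok 1 1 dF1 dF2 d2F1 h1_1 -> theta_ok 1 2 dF1 dF2 d2F2 h1_2 ->
  theta_ok 2 1 dF1 dF2 d2F1 h2_1 -> theta_ok 2 2 dF1 dF2 d2F2 h2_2 ->
  0 < eps0 ->
  convex_quadrant (fun r1 r2 => F1 r1 + F2 r2 + 2 * eps0 * h r1 r2) ->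
  0 < eps <= eps0 ->
  forall rho1 rho2 : 'rV[R]_d -> R,
  inX0 rho1 rho2 ->
  (forall s1 s2 : 'rV[R]_d -> R, P2dens s1 -> P2dens s2 ->
     (energy K F1 F2 h eps rho1 rho2 <= energy K F1 F2 h eps s1 s2)%E) ->
  exists C1 C2 : R, [/\ 0 < C1, 0 < C2,
    ae_Rd (fun x => dF1 (rho1 x) + eps * h1 (rho1 x) (rho2 x)
                 = Num.max (C1 - convol K rho2 x) 0),
    ae_Rd (fun x => dF2 (rho2 x) + eps * h2 (rho1 x) (rho2 x)
                 = Num.max (C2 - convol K rho1 x) 0) &
    [/\ supp_dens rho1 = [set x | convol K rho2 x <= C1],
        supp_dens rho2 = [set x | convol K rho1 x <= C2],
        compact (supp_dens rho1) /\ convex_set_rV (supp_dens rho1) &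
        compact (supp_dens rho2) /\ convex_set_rV (supp_dens rho2)]].
Proof.
move=> /Khyp_confining K_confining F1_hyp F2_hyp h_hyp _ _ _ _ _ cvx eps_bnd rho1 rho2.
move=> [rho1P rho2P _] energy_min.
have energy_swap_min s2 s1 : P2dens s2 -> P2dens s1 ->
    (energy K F2 F1 (fun r1 r2 => h r2 r1) eps rho2 rho1 <=
     energy K F2 F1 (fun r1 r2 => h r2 r1) eps s2 s1)%E.
  move=> s2P s1P; have swapE := energy_swap K_confining F1_hyp F2_hyp h_hyp cvx eps_bnd.
  by rewrite -!swapE//; exact: energy_min.
have [C1 [C1_gt0 EL1 supp1 compact1 convex1]] :=
  minimizer_first_component K_confining F1_hyp F2_hyp h_hyp cvx eps_bnd rho1P rho2P energy_min.
have [C2 [C2_gt0 EL2 supp2 compact2 convex2]] :=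
  minimizer_first_component K_confining F2_hyp F1_hyp (hhyp_swap h_hyp)
    (convex_quadrant_swap cvx) eps_bnd rho2P rho1P energy_swap_min.
by exists C1, C2; split.
Qed.
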